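(* Let $d\ge1$, $s>d+1$, and let $\{\kappa_\lambda\}_{\lambda\in\Lambda}$ be the weighted Meyer wavelet atoms on $\mathbb R^d$. Fix distinct data sites $x_1,\dots,x_N\in\mathbb R^d$ and let $G:\mathbb R^N\to[0,+\infty]$ be proper, lower semicontinuous, and coercive. For $\mu>0$, consider the problem $$\min_{f\in B^s_{1,1}(\mathbb R^d)}G\big(f(x_1),\dots,f(x_N)\big)+\mu\|f\|_{\mathcal U}.\qquad(\mathrm P)$$ Then the solution set is nonempty and there exists a minimizer $f^\star$ of $(\mathrm P)$ of the form $$f^\star=\sum_{j=1}^Ka_j\kappa_{\lambda_j},\qquad K\le N,$$ for some $a_1,\dots,a_K\in\mathbb R$ and $\lambda_1,\dots,\lambda_K\in\Lambda$. Moreover, for every $K\ge N$, the problem $$\min_{\substack{a_1,\dots,a_K\in\mathbb R\\\lambda_1,\dots,\lambda_K\in\Lambda}}G\Big(\sum_{j=1}^Ka_j\kappa_{\lambda_j}(x_1),\dots,\sum_{j=1}^Ka_j\kappa_{\lambda_j}(x_N)\Big)+\mu\sum_{j=1}^K|a_j|$$ has a nonempty solution set, and any solution $(a^\star,\lambda^\star)\in\mathbb R^K\times\Lambda^K$ induces a solution $\sum_{j=1}^Ka_j^\star\kappa_{\lambda_j^\star}$ of $(\mathrm P)$.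
   Context: **Besov space.** With $\Delta_hf(x)=f(x+h)-f(x)$, $\Delta_h^r$ its $r$-fold iterate, $\omega_r(f,t)_{L^1}=\sup_{\|h\|_2\le t}\|\Delta_h^rf\|_{L^1}$, and any fixed integer $r>s$, $B^s_{1,1}(\mathbb R^d)$ is the space of measurable $f:\mathbb R^d\to\mathbb R$ with $\|f\|_{L^1}+\int_0^1t^{-s}\omega_r(f,t)_{L^1}\frac{dt}{t}<+\infty$. (For $s>d+1$ elements are identified with their Lipschitz representatives, so point values make sense.) **Wavelets.** $\phi,\psi\in\mathcal S(\mathbb R)$ are the real Meyer scaling function and associated Meyer wavelet on $\mathbb R$. Put $\eta_0=\phi$, $\eta_1=\psi$; for $\varepsilon\in\{0,1\}^d$, $\psi^\varepsilon(x)=\prod_{i=1}^d\eta_{\varepsilon_i}(x_i)$, $\phi^{(d)}=\psi^{(0,\dots,0)}$. For $k\in\mathbb Z^d$, $j\in\mathbb N_0$, $\varepsilon\ne0$: $\phi_k(x)=\phi^{(d)}(x-k)$, $\psi^\varepsilon_{j,k}(x)=2^{jd/2}\psi^\varepsilon(2^jx-k)$; together these form an orthonormal basis of $L^2(\mathbb R^d)$. $\Lambda=\mathbb Z^d\cup\big(\mathbb N_0\times\mathbb Z^d\times(\{0,1\}^d\setminus\{0\})\big)$ (disjoint union). Weighted atoms: $\kappa_\lambda=\phi_k$ for $\lambda=k\in\mathbb Z^d$, and $\kappa_\lambda=2^{-j(s-d/2)}\psi^\varepsilon_{j,k}$ for $\lambda=(j,k,\varepsilon)$. The map $T:\ell^1(\Lambda)\to\mathcal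 S'(\mathbb R^d)$, $Ta=\sum_\lambda a_\lambda\kappa_\lambda$, is injective; its range $\mathcal U$ has norm $\|f\|_{\mathcal U}=\|T^{-1}f\|_{\ell^1}$. By Meyer's wavelet characterization, $\mathcal U=B^s_{1,1}(\mathbb R^d)$ as sets, with equivalent norms. $G$ coercive means its sublevel sets are bounded; proper means finite somewhere. *)

(* Defs.v *)
From HB Require Import structures.
From mathcomp Require Import all_boot all_order all_algebra.
From mathcomp Require Import all_classical all_reals all_analysis.
Set Implicit Arguments.
Unset Strict Implicit.
Unset Printing Implicit Defensive.
Import Order.TTheory GRing.Theory Num.Theory.
Import numFieldNormedType.Exports.
Local Open Scope classical_set_scope.
Local Open Scope ring_scope.

Definition minimizer (R : realType) (X : Type) (A : set X) (J : X -> \bar R)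
    (x : X) : Prop :=
  A x /\ forall y, A y -> (J x <= J y)%E.

Definition proper_fun (R : realType) (X : Type) (G : X -> \bar R) : Prop :=
  exists y, (G y < +oo)%E.

Definition coercive_fun (R : realType) (n : nat) (G : 'rV[R]_n -> \bar R) :
    Prop :=
  forall c : R, bounded_set [set y | (G y <= c%:E)%E].

(* Lebesgue measure on R^n. The library puts the product sigma-algebra on
   n.-tuple R and no measurable structure on 'rV[R]_n, so the measure is built
   on tuples, by iterating the binary product. *)

Section lebesgue_tuple.
Context (R : realType).
Local Notation mR := (measurableTypeR R).

Definition cons_pair (n : nat) (p : mR * n.-tuple mR) : n.+1.-tuple mR :=
  [tuple of p.1 :: p.2].

Lemma measurable_cons_pair (n : nat) :
  measurable_fun [set: mR * n.-tuple mR] (@cons_pair n).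
Proof. exact: measurable_cons. Qed.

Section cons_measure.
Context (n : nat) (m : {sigma_finite_measure set (n.-tuple mR) -> \bar R}).

Definition cons_measure : set (n.+1.-tuple mR) -> \bar R :=
  pushforward (@lebesgue_measure R \x m)%E (@cons_pair n).

Let cons_measure0 : cons_measure set0 = 0%E.
Proof. by rewrite /cons_measure /pushforward preimage_set0 measure0. Qed.

Let cons_measure_ge0 A : (0 <= cons_measure A)%E.
Proof. by rewrite /cons_measure /pushforward measure_ge0. Qed.

Let cons_measure_semi_sigma_additive : semi_sigma_additive cons_measure.
Proof.
have mpre A : measurable A -> measurable (@cons_pair n @^-1` A).
  by move=> mA; rewrite -[X in measurable X]setTI; exact: measurable_cons_pair.
move=> F mF tF mUF; rewrite /cons_measure /pushforward preimage_bigcup.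
apply: measure_semi_sigma_additive => [k||]; first exact: mpre.
- apply/trivIsetP => /= i j _ _ ij; rewrite -preimage_setI.
  by move/trivIsetP : tF => /(_ _ _ _ _ ij) ->//; rewrite preimage_set0.
- by rewrite -preimage_bigcup; exact: mpre.
Qed.

HB.instance Definition _ := isMeasure.Build _ _ _ cons_measure
  cons_measure0 cons_measure_ge0 cons_measure_semi_sigma_additive.

Let cons_measure_sigma_finite : sigma_finite setT cons_measure.
Proof.
have /sigma_finiteP[F [TF ndF Foo]] := sigma_finiteT (@lebesgue_measure R).
have /sigma_finiteP[G [TG ndG Goo]] := sigma_finiteT m.
pose u (v : n.+1.-tuple mR) : mR * n.-tuple mR :=
  (thead v, [tuple of behead v]).
have mu : measurable_fun setT u.
  by apply/measurable_fun_pairP; split;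
    [exact: measurable_tnth|exact: measurable_behead].
have uK : cancel (@cons_pair n) u.
  by case=> x v; rewrite /u /cons_pair/= theadE; congr pair; apply: val_inj.
exists (fun k => u @^-1` (F k `*` G k)) => [|k].
  rewrite -preimage_bigcup; apply/seteqP; split=> // v _ /=.
  have [i _ Fi] : (\bigcup_i F i) (u v).1 by rewrite -TF.
  have [j _ Gj] : (\bigcup_i G i) (u v).2 by rewrite -TG.
  exists (maxn i j) => //; split.
    by apply: subsetPset (ndF _ _ (leq_maxl i j)) _ Fi.
  by apply: subsetPset (ndG _ _ (leq_maxr i j)) _ Gj.
have [mF Fk] := Foo k; have [mG Gk] := Goo k; split.
  by rewrite -[X in measurable X]setTI; apply: mu => //; exact: measurableX.
rewrite /cons_measure /pushforward -comp_preimage.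
rewrite (_ : u \o _ = id) ?preimage_id; last by apply/funext => p; exact: uK.
by rewrite product_measure1E// lte_mul_pinfty// ge0_fin_numE.
Qed.

HB.instance Definition _ :=
  Measure_isSigmaFinite.Build _ _ _ cons_measure cons_measure_sigma_finite.

End cons_measure.

Fixpoint lebesgue_tuple (n : nat) :
    {sigma_finite_measure set (n.-tuple mR) -> \bar R} :=
  if n is n'.+1 then cons_measure (lebesgue_tuple n')
  else \d_([tuple] : 0.-tuple mR).

End lebesgue_tuple.

Definition row_of_tuple (R : realType) (d : nat)
    (v : d.-tuple (measurableTypeR R)) : 'rV[R]_d :=
  \row_i tnth v i.

Definition L1norm (R : realType) (d : nat) (f : 'rV[R]_d -> R) : \bar R :=
  (\int[lebesgue_tuple R d]_v (`|f (row_of_tuple v)|)%:E)%E.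

Definition norm2 (R : realType) (d : nat) (h : 'rV[R]_d) : R :=
  Num.sqrt (\sum_i (h ord0 i) ^+ 2).

Definition fdiff (R : realType) (d : nat) (h : 'rV[R]_d) (f : 'rV[R]_d -> R) :
    'rV[R]_d -> R :=
  fun x => f (x + h) - f x.

Definition modulus (R : realType) (d r : nat) (f : 'rV[R]_d -> R) (t : R) :
    \bar R :=
  ereal_sup [set L1norm (iter r (fdiff h) f) | h in [set h | norm2 h <= t]].

Definition besov_norm (R : realType) (d : nat) (s : R) (r : nat)
    (f : 'rV[R]_d -> R) : \bar R :=
  (L1norm f + \int[lebesgue_measure]_(t in `]0%R, 1%R]%classic)
                 ((t `^ (- s) / t)%R%:E * modulus r f t))%E.

(* The Besov space as a set of functions: for s > d + 1 each class modulo null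
   sets has exactly one Lipschitz representative, and that is the element kept
   here, so that point values are meaningful. The space does not depend on the
   integer r > s. *)
Definition besov (R : realType) (d : nat) (s : R) (r : nat) :
    set ('rV[R]_d -> R) :=
  [set f : 'rV[R]_d -> R |
    [/\ measurable_fun [set: d.-tuple (measurableTypeR R)]
          (fun v => f (row_of_tuple v) : measurableTypeR R),
        (besov_norm s r f < +oo)%E
      & lipschitz (f : 'rV[R]_d -> R^o)]].

(* A cutoff nu determines a Meyer pair; any admissible one may be used. *)
Definition meyer_cutoff (R : realType) (nu : R -> R) : Prop :=
  [/\ forall (n : nat) (x : R), derivable (derive1n n (nu : R -> R^o)) x 1,
      forall x, x <= 0 -> nu x = 0,
      forall x, 1 <= x -> nu x = 1
    & forall x, nu x + nu (1 - x) = 1].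

(* The Fourier transform of the scaling function: it is 1 for
   |xi| <= 2 pi / 3, it is cos (pi/2 nu (3 |xi| / (2 pi) - 1)) for
   2 pi / 3 <= |xi| <= 4 pi / 3, and it vanishes beyond; nu being 0 on the left
   of 0 and 1 on the right of 1, one formula covers the three cases. *)
Definition meyer_lowpass (R : realType) (nu : R -> R) (xi : R) : R :=
  cos (pi / 2 * nu (3 * `|xi| / (2 * pi) - 1)).

(* The Fourier transform of the wavelet is exp (- i xi / 2) times this. It is
   sin (pi/2 nu (3 |xi| / (2 pi) - 1)) for 2 pi / 3 <= |xi| <= 4 pi / 3 and
   cos (pi/2 nu (3 |xi| / (4 pi) - 1)) for 4 pi / 3 <= |xi| <= 8 pi / 3, and it
   vanishes elsewhere. *)
Definition meyer_bandpass (R : realType) (nu : R -> R) (xi : R) : R :=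
  sin (pi / 2 * nu (3 * `|xi| / (2 * pi) - 1)) * meyer_lowpass nu (xi / 2).

(* Inverse Fourier transform of a real even function, for the convention
   (F f) xi = \int f x exp (- i x xi) dx. *)
Definition inv_fourier_even (R : realType) (g : R -> R) (x : R) : R :=
  (2 * pi)^-1 *
    \int[@lebesgue_measure R]_(xi in [set: R]) (g xi * cos (x * xi)).

Definition meyer_phi (R : realType) (nu : R -> R) : R -> R :=
  inv_fourier_even (meyer_lowpass nu).

(* The factor exp (- i xi / 2) is the translation by 1/2. *)
Definition meyer_psi (R : realType) (nu : R -> R) (x : R) : R :=
  inv_fourier_even (meyer_bandpass nu) (x - 1 / 2).

(* psi^eps, with eps i = true standing for eps_i = 1 *)
Definition tensor_wavelet (R : realType) (d : nat) (nu : R -> R)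
    (eps : {ffun 'I_d -> bool}) (x : 'rV[R]_d) : R :=
  \prod_i (if eps i then meyer_psi nu else meyer_phi nu) (x ord0 i).

Definition nonzero_type (d : nat) : choiceType :=
  {eps : {ffun 'I_d -> bool} | [exists i, eps i]}.

(* inl k indexes the integer translates of the scaling function, and
   inr (j, k, eps), eps <> 0, the wavelets of scale j. *)
Definition wavelet_index (d : nat) : choiceType :=
  ('rV[int]_d + nat * 'rV[int]_d * nonzero_type d)%type.

Definition int_shift (R : realType) (d : nat) (k : 'rV[int]_d) : 'rV[R]_d :=
  map_mx intr k.

Definition wavelet (R : realType) (d : nat) (nu : R -> R) (j : nat)
    (k : 'rV[int]_d) (eps : {ffun 'I_d -> bool}) (x : 'rV[R]_d) : R :=
  2 `^ (j%:R * d%:R / 2) *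
    tensor_wavelet nu eps (2 ^+ j *: x - int_shift R k).

Definition atom (R : realType) (d : nat) (nu : R -> R) (s : R)
    (l : wavelet_index d) : 'rV[R]_d -> R :=
  match l with
  | inl k => fun x => tensor_wavelet nu [ffun=> false] (x - int_shift R k)
  | inr (j, k, eps) => fun x =>
      2 `^ (- (j%:R * (s - d%:R / 2))) * wavelet nu j k (val eps) x
  end.

(* Sum of an absolutely summable real family. *)
Definition sum_family (R : realType) (I : choiceType) (u : I -> R) : R :=
  fine (\esum_(i in [set: I]) (u^\+ i)%:E) -
  fine (\esum_(i in [set: I]) (u^\- i)%:E).

Definition l1norm (R : realType) (I : choiceType) (a : I -> R) : \bar R :=
  \esum_(i in [set: I]) (`|a i|)%:E.

Definition l1 (R : realType) (I : choiceType) : set (I -> R) :=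
  [set a | (l1norm a < +oo)%E].

(* For s > d the atoms are uniformly bounded, so for a in l1 the series
   converges absolutely and uniformly; its pointwise sum is the continuous
   function representing the sum in S'. *)
Definition synthesis (R : realType) (d : nat) (nu : R -> R) (s : R)
    (a : wavelet_index d -> R) : 'rV[R]_d -> R :=
  fun x => sum_family (fun l => a l * atom nu s l x).

(* The l1 norm of the preimage of f under synthesis. As synthesis is injective
   on l1, the set below has at most one element, which ereal_inf extracts; off
   the range of synthesis, which is the Besov space, the value is +oo. *)
Definition U_norm (R : realType) (d : nat) (nu : R -> R) (s : R)
    (f : 'rV[R]_d -> R) : \bar R :=
  ereal_inf [set l1norm a | a in [set a | l1 a /\ synthesis nu s a = f]].

Definition atomic_sum (R : realType) (d : nat) (nu : R -> R) (s : R) (K : nat)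
    (a : 'I_K -> R) (l : 'I_K -> wavelet_index d) : 'rV[R]_d -> R :=
  fun x => \sum_(j < K) a j * atom nu s (l j) x.

Definition samples (R : realType) (d N : nat) (x : 'I_N -> 'rV[R]_d)
    (f : 'rV[R]_d -> R) : 'rV[R]_N :=
  \row_i f (x i).

Definition objective (R : realType) (d N : nat) (nu : R -> R) (s mu : R)
    (x : 'I_N -> 'rV[R]_d) (G : 'rV[R]_N -> \bar R) (f : 'rV[R]_d -> R) :
    \bar R :=
  (G (samples x f) + mu%:E * U_norm nu s f)%E.

Definition discrete_objective (R : realType) (d N : nat) (nu : R -> R)
    (s mu : R) (x : 'I_N -> 'rV[R]_d) (G : 'rV[R]_N -> \bar R) (K : nat)
    (p : ('I_K -> R) * ('I_K -> wavelet_index d)) : \bar R :=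
  (G (samples x (atomic_sum nu s p.1 p.2)) +
   (mu * \sum_(j < K) `|p.1 j|)%:E)%E.

(* Main.v *)
Require Import Defs.
From mathcomp Require Import all_boot all_order all_algebra.
From mathcomp Require Import all_classical all_reals all_analysis.
From mathcomp Require Import measurable_realfun zify ring lra.
Set Implicit Arguments.
Unset Strict Implicit.
Unset Printing Implicit Defensive.
Import Order.TTheory GRing.Theory Num.Theory.
Import numFieldNormedType.Exports.
Local Open Scope classical_set_scope.
Local Open Scope ring_scope.

(* Only finite linear combinations of atoms have to be compared with arbitrary
   f = sum_l a_l kappa_l, and f enters the data term through the vector
   sum_l a_l v_l, where v_l in R^N lists the values of kappa_l at the sites.
   The rapid decay of the Meyer functions makes v_l tend to 0 at infinity of the
   index set, so B = {0} u {v_l} is compact. Caratheodory's argument rewrites a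
   finite combination of elements of B as one of N elements without increasing
   the l1 norm of the coefficients, and the N-term combinations with coefficients
   of l1 norm at most c form the image of a compact set, hence a closed set: it
   contains sum_l a_l v_l as soon as the l1 norm of a is at most c. The cost is
   lower semicontinuous on this compact set of parameters, so it has a minimizer
   there, and the minimizer beats every f.

   Finite combinations of atoms lie in the Besov space because the r-th
   difference of a tensor product of smooth functions with quadratic decay is at
   most C |h|^r times the product of the 1 / (1 + x_i^2). The Meyer functions have
   this decay by two integrations by parts in the Fourier integral. *)

(** * Sparse combinations in R^N *)

(** If the infimum [m] were not attained, semicontinuity would give each point of [K] a
    neighbourhood where [F] exceeds [m + 1/(n+1)] for all large [n]; by compactness one [n] serves
    all of [K], contradicting the infimum. *)
Lemma lsc_compact_minimizer (R : realType) (X : topologicalType) (K : set X)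
    (F : X -> \bar R) :
  compact K -> K !=set0 -> (forall x, (0 <= F x)%E) ->
  lower_semicontinuous F -> exists x, minimizer K F x.
Proof.
move=> cK [x0 Kx0] F0 lscF.
set m := ereal_inf (F @` K).
have mF y : K y -> (m <= F y)%E by move=> Ky; apply: ereal_inf_lbound; exists y.
have m0 : (0 <= m)%E by apply: le_ereal_inf_tmp => _ [y Ky <-].
have [[x [Kx Fx]]|nomin] := pselect (exists x, K x /\ (F x <= m)%E).
  by exists x; split=> // y Ky; exact: le_trans Fx (mF _ Ky).
have mlt y : K y -> (m < F y)%E.
  by move=> Ky; rewrite ltNge; apply/negP => Fy; apply: nomin; exists y.
have mfin : m \is a fin_num.
  by rewrite ge0_fin_numE// (lt_le_trans (mlt _ Kx0))// leey.
have := (compact_near_coveringP K).1 cK nat \oo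
  (fun n y => ((fine m + n.+1%:R^-1)%:E < F y)%E) _.
case=> [y Ky|n _ /(_ n (leqnn n)) Kn].
  have [c mc cF] : exists2 c : R, fine m < c & (c%:E < F y)%E.
    move: (mlt _ Ky); rewrite -(fineK mfin); case: (F y) => [b||]//.
    - rewrite lte_fin => mb; exists ((fine m + b) / 2); first by rewrite midf_lt.
      by rewrite lte_fin midf_lt.
    - by move=> _; exists (fine m + 1); [rewrite ltrDl|rewrite ltry].
  have [V yV VF] := lscF _ _ cF.
  exists (V, [set n | n.+1%:R^-1 < c - fine m]) => /=.
    split=> //; apply: near_infty_natSinv_lt (PosNum _).
    by rewrite subr_gt0.
  move=> [z n] /= [Vz nc]; apply: le_lt_trans (VF _ Vz).
  by rewrite lee_fin -lerBrDl ltW.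
suff : (fine m + n.+1%:R^-1 <= fine m)%R.
  by rewrite gerDl leNgt invr_gt0 ltr0n.
rewrite -lee_fin (fineK mfin); apply: le_ereal_inf_tmp => _ [y Ky <-].
exact/ltW/Kn.
Qed.

(** The matrix with rows [u i] has rank at most N < M, so its left kernel is nonzero. *)
Lemma exists_row_relation (R : realType) (N M : nat) (u : 'I_M -> 'rV[R]_N) :
  (N < M)%N ->
  exists c : 'I_M -> R, \sum_i c i *: u i = 0 /\ exists i, c i != 0.
Proof.
move=> NM; pose A : 'M[R]_(M, N) := \matrix_i u i.
have : kermx A != 0.
  rewrite kermx_eq0 /row_free neq_ltn (leq_ltn_trans _ NM)//.
  exact: rank_leq_col.
case/matrix0Pn => i [j kij]; exists (fun k => kermx A i k); split; last by exists j.
have := mulmx_ker A => /(congr1 (row i)).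
rewrite row0 row_mul mulmx_sum_row; apply: etrans.
by apply: eq_bigr => k _; rewrite rowK [in RHS]mxE.
Qed.

(* Moving along a linear relation in a direction which does not increase the
   l1 norm, until the first coefficient vanishes. *)
Lemma drop_dependent (R : realType) (N M : nat) (u : 'I_M.+1 -> 'rV[R]_N)
    (a : 'I_M.+1 -> R) : (N < M.+1)%N ->
  exists (i : 'I_M.+1) (b : 'I_M -> R),
    \sum_j b j *: u (lift i j) = \sum_j a j *: u j /\
    \sum_j `|b j| <= \sum_j `|a j|.
Proof.
move=> NM.
suff [i [b [bi0 bu ba]]] : exists i (b : 'I_M.+1 -> R), [/\ b i = 0,
    \sum_j b j *: u j = \sum_j a j *: u j & \sum_j `|b j| <= \sum_j `|a j|].
  exists i, (fun j => b (lift i j)); split.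
    by rewrite -bu [RHS](bigD1_ord i)//= bi0 scale0r add0r.
  by apply: le_trans ba; rewrite [leRHS](bigD1_ord i)//= bi0 normr0 add0r.
have [/existsP[i /eqP ai0]|/existsPn an0] := boolP [exists i, a i == 0].
  by exists i, a.
have [c' [cu' [i0' ci0']]] := exists_row_relation u NM.
(* Where no coefficient vanishes, [e c] is the derivative of the l1 norm at [a] along [c]. Up to
   replacing [c] by its opposite it is nonnegative, so that moving to [a - t c] does not increase
   the norm. *)
pose e c := \sum_j Num.sg (a j) * c j : R.
have [c [cu [i0 ci0] ec]] : exists c : 'I_M.+1 -> R,
    [/\ \sum_i c i *: u i = 0, (exists i, c i != 0) & 0 <= e c].
  have [ec|ec] := leP 0 (e c'); first by exists c'; split => //; exists i0'.
  exists (fun i => - c' i); split.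
  - by under eq_bigr do rewrite scaleNr; rewrite sumrN cu' oppr0.
  - by exists i0'; rewrite oppr_eq0.
  - by rewrite /e; under eq_bigr do rewrite mulrN; rewrite sumrN oppr_ge0 ltW.
have [i1 ci1] : exists i, 0 < Num.sg (a i) * c i.
  apply: contrapT => H.
  have c0 i : Num.sg (a i) * c i <= 0.
    by rewrite leNgt; apply/negP => ?; apply: H; exists i.
  have : - (Num.sg (a i0) * c i0) = 0.
    apply: (psumr_eq0P (P := predT) (F := fun i => - (Num.sg (a i) * c i))) => //.
      by move=> i _; rewrite oppr_ge0.
    apply/eqP; rewrite sumrN oppr_eq0 eq_le ec andbT.
    by apply: sumr_le0 => i _.
  by move/eqP; rewrite oppr_eq0 mulf_eq0 sgr_eq0 (negbTE (an0 _)) (negbTE ci0).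
(* [t i] is the time at which coefficient [i] of [a - t c] reaches zero; up to the smallest such
   time no coefficient changes sign ([key]), so the norm is affine in [t] so far. *)
pose t i := `|a i| / (Num.sg (a i) * c i).
case: (@arg_minP _ _ _ i1 (fun i => 0 < Num.sg (a i) * c i) t ci1) => i ci tmin.
have ti0 : 0 <= t i by rewrite divr_ge0// ltW.
have key j : 0 <= Num.sg (a j) * (a j - t i * c j).
  rewrite mulrBr mulrCA -normrEsg subr_ge0.
  have [cj|cj] := ltP 0 (Num.sg (a j) * c j).
    by rewrite -ler_pdivlMr//; exact: tmin.
  by rewrite (le_trans _ (normr_ge0 _))// mulr_ge0_le0.
exists i, (fun j => a j - t i * c j); split.
- have sn0 : Num.sg (a i) != 0 by rewrite sgr_eq0.
  apply: (mulfI sn0); rewrite mulr0 mulrBr mulrCA -normrEsg /t.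
  by rewrite divfK ?subrr// gt_eqF.
- under eq_bigr do rewrite scalerBl -scalerA.
  by rewrite sumrB -scaler_sumr cu scaler0 subr0.
- rewrite (_ : \sum_j _ = \sum_j `|a j| - t i * e c).
    by rewrite gerBl mulr_ge0.
  rewrite /e mulr_sumr -sumrB; apply: eq_bigr => j _.
  rewrite -[LHS](@mul1r R) -(_ : `|Num.sg (a j)| = 1).
    by rewrite -normrM ger0_norm// mulrBr mulrCA -normrEsg.
  by rewrite normr_sg an0.
Qed.

(** Terms are dropped one by one while there are more than N; a shorter combination is padded with
    zero coefficients on the vector 0 of [B]. *)
Lemma caratheodory_l1 (R : realType) (N M : nat) (B : set 'rV[R]_N)
    (u : 'I_M -> 'rV[R]_N) (a : 'I_M -> R) :
  B 0 -> (forall i, B (u i)) ->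
  exists (w : 'I_N -> 'rV[R]_N) (b : 'I_N -> R),
    [/\ forall j, B (w j), \sum_j b j *: w j = \sum_j a j *: u j &
        \sum_j `|b j| <= \sum_j `|a j|].
Proof.
move=> B0; elim: M u a => [|M IH] u a Bu.
  exists (fun=> 0), (fun=> 0); split=> //.
    by rewrite big_ord0 big1// => j _; rewrite scaler0.
  by rewrite big_ord0 big1// => j _; rewrite normr0.
have [NM|MN] := ltnP N M.+1.
  have [i [b [bu ba]]] := drop_dependent u a NM.
  have [w [b' [Bw bw le]]] := IH (fun j => u (lift i j)) b (fun j => Bu _).
  by exists w, b'; split=> //; [rewrite bw|apply: le_trans ba].
pose f (V : nmodType) (v : 'I_M.+1 -> V) (j : 'I_N) : V :=
  if insub (nat_of_ord j) is Some i then v i else 0.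
have sumf (V : nmodType) (v : 'I_M.+1 -> V) : \sum_j f V v j = \sum_i v i.
  pose g k := if insub k is Some i then v i else 0.
  rewrite (_ : \sum_i v i = \sum_(i < M.+1) g i); last first.
    by apply: eq_bigr => i _; rewrite /g valK.
  rewrite (big_ord_widen N g MN) [RHS]big_mkcond /=; apply: eq_bigr => j _.
  by rewrite /f /g; case: ifPn => // h; rewrite insubF//; exact: negbTE.
exists (f _ u), (f _ a); split.
- by move=> j; rewrite /f; case: insub.
- rewrite -sumf; apply: eq_bigr => j _; rewrite /f; case: insub => //.
  by rewrite scaler0.
- rewrite -(sumf _ (fun i => `|a i|)); apply: ler_sum => j _; rewrite /f.
  by case: insub => //; rewrite normr0.
Qed.

(** * Summable families and their finite partial sums *)

Lemma summable_nonneg_approx (R : realType) (I : choiceType) (u : I -> R) (e : R) :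
  (forall i, 0 <= u i) -> (\esum_(i in [set: I]) (u i)%:E < +oo)%E -> 0 < e ->
  exists2 F : set I, finite_set F & forall F', finite_set F' -> F `<=` F' ->
    `|fine (\esum_(i in [set: I]) (u i)%:E) - \sum_(i \in F') u i| <= e.
Proof.
move=> u0 uoo e0; set S := (\esum_(i in _) _)%E in uoo *.
have S0 : (0 <= S)%E by apply: esum_ge0 => i _; rewrite lee_fin.
have Sfin : S \is a fin_num by rewrite ge0_fin_numE.
(* The sum is the supremum of the finite partial sums, so some [F] comes within [e]; a larger finite
   set gives a value between that one and the total. *)
have [_ [F [finF _] <-]] := ub_ereal_sup_adherent e0 Sfin.
rewrite -/(esum _ _) -/S => SF; exists F => // F' finF' FF'.
have SF' : (\sum_(i \in F') u i <= fine S)%R.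
  rewrite -lee_fin fineK// -fsumEFin//; apply: ereal_sup_ubound.
  by exists F' => //; split.
have FF : (\sum_(i \in F) u i <= \sum_(i \in F') u i)%R.
  rewrite -lee_fin -!fsumEFin//; apply: lee_fsum_nneg_subset => //.
    by move=> i; rewrite !inE; exact: FF'.
  by move=> i _; rewrite lee_fin.
move: SF; rewrite -(fineK Sfin) fsumEFin// -EFinB lte_fin => SF.
rewrite ger0_norm ?subr_ge0//; lra.
Qed.

Lemma le_l1norm_pos_neg (R : realType) (I : choiceType) (u : I -> R) :
  (\esum_(i in [set: I]) (u^\+ i)%:E <= l1norm u)%E /\
  (\esum_(i in [set: I]) (u^\- i)%:E <= l1norm u)%E.
Proof.
split; apply: le_esum => i _; rewrite lee_fin /funrpos /funrneg.
  by rewrite ge_max normr_ge0 ler_norm.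
by rewrite ge_max normr_ge0 -normrN ler_norm.
Qed.

(** Positive and negative parts are each approximated within [e / 2], and the union of the two
    finite sets serves for the difference. *)
Lemma sum_family_approx (R : realType) (I : choiceType) (u : I -> R) (e : R) :
  l1 u -> 0 < e ->
  exists2 F : set I, finite_set F & forall F', finite_set F' -> F `<=` F' ->
    `|sum_family u - \sum_(i \in F') u i| <= e.
Proof.
rewrite /l1/= => u1 e0; have [lep len] := le_l1norm_pos_neg u.
have e20 : 0 < e / 2 by rewrite divr_gt0.
have [F1 fF1 H1] := summable_nonneg_approx (funrpos_ge0 u) (le_lt_trans lep u1) e20.
have [F2 fF2 H2] := summable_nonneg_approx (funrneg_ge0 u) (le_lt_trans len u1) e20.
exists (F1 `|` F2) => [|F' fF']; first by rewrite finite_setU.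
rewrite subUset => -[FF1 FF2].
rewrite /sum_family [X in _ - X](_ : _ =
    \sum_(i \in F') u^\+ i - \sum_(i \in F') u^\- i).
  move: (H1 _ fF' FF1) (H2 _ fF' FF2); rewrite !ler_norml.
  by move=> /andP[? ?] /andP[? ?]; apply/andP; split; lra.
rewrite !fsbig_finite// -sumrB; apply: eq_bigr => i _.
by rewrite -[in LHS](funrposBneg u).
Qed.

Lemma sum_family_finite (R : realType) (I : choiceType) (u : I -> R) (S : set I) :
  finite_set S -> (forall i, ~ S i -> u i = 0) -> sum_family u = \sum_(i \in S) u i.
Proof.
move=> fS u0.
have key (f : I -> R) : (forall i, 0 <= f i) -> (forall i, ~ S i -> f i = 0) ->
    fine (\esum_(i in [set: I]) (f i)%:E) = \sum_(i \in S) f i.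
  move=> f0 fS0; rewrite [X in fine X](_ : _ = \esum_(i in S) (f i)%:E)%E.
    by rewrite esum_fset// ?fsumEFin// => i _; rewrite lee_fin.
  rewrite [RHS]esum_mkcond; apply: eq_esum => i _.
  by case: ifPn => //; rewrite notin_setE => /fS0 ->.
rewrite /sum_family (key _ (funrpos_ge0 u)); last first.
  by move=> i /u0; rewrite /funrpos => ->; rewrite maxxx.
rewrite (key _ (funrneg_ge0 u)); last first.
  by move=> i /u0; rewrite /funrneg => ->; rewrite oppr0 maxxx.
rewrite !fsbig_finite// -sumrB; apply: eq_bigr => i _.
by rewrite -[in RHS](funrposBneg u).
Qed.

Lemma l1_bounded_mul (R : realType) (I : choiceType) (a c : I -> R) (C : R) :
  l1 a -> (forall i, `|c i| <= C) -> l1 (fun i => a i * c i).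
Proof.
rewrite /l1/= => a1 cC.
(* Nonnegativity of [C] is read off at some index, so the empty index set is treated apart. *)
have [/eqP F0|/set0P[i _]] := boolP ([set: I] == set0).
  by rewrite /l1norm F0 esum_set0.
have C0 : 0 <= C := le_trans (normr_ge0 _) (cC i).
have afin : l1norm a \is a fin_num.
  by rewrite ge0_fin_numE//; apply: esum_ge0 => j _; rewrite lee_fin.
apply: (@le_lt_trans _ _ (C * fine (l1norm a))%:E); last by rewrite ltry.
apply: ge_ereal_sup => _ [X [finX _] <-].
rewrite fsumEFin// lee_fin.
apply: (@le_trans _ _ (C * \sum_(j \in X) `|a j|)); last first.
  rewrite ler_wpM2l// -lee_fin fineK// -fsumEFin//.
  by apply: ereal_sup_ubound; exists X.
rewrite !fsbig_finite// mulr_sumr; apply: ler_sum => j _.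
by rewrite normrM mulrC ler_wpM2r.
Qed.

(** Convergence to 0 along the cofinite subsets of the index set, the condition defining c_0. *)
Definition vanishing (R : realType) (I : choiceType) (N : nat)
    (v : I -> 'rV[R]_N) :=
  forall e, 0 < e -> finite_set [set i | e < `|v i|].

Lemma vanishing_bounded (R : realType) (I : choiceType) (N : nat)
    (v : I -> 'rV[R]_N) : vanishing v -> exists C, forall i, `|v i| <= C.
Proof.
move=> v0; have fS := v0 1 ltr01.
have [C [_ HC]] := compact_bounded (finite_compact (finite_image v fS)).
exists (Num.max 1 (C + 1)) => i; rewrite le_max.
have [//|vi] := leP `|v i| 1; rewrite /=.
by apply: HC; [rewrite ltrDl|exists i].
Qed.

(** For closedness: close to a nonzero limit point [p] the set has only values of norm above
    [|p| / 2], and these form a finite, hence closed, set. *)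
Lemma vanishing_compact (R : realType) (I : choiceType) (N : nat)
    (v : I -> 'rV[R]_N) : vanishing v -> compact ([set 0] `|` range v).
Proof.
move=> v0; apply: bounded_closed_compact.
  have [C HC] := vanishing_bounded v0.
  exists (Num.max 0 C); split; first exact: num_real.
  move=> M; rewrite gt_max => /andP[M0 CM] _ [->|[i _ <-]].
    by rewrite /= normr0 ltW.
  by rewrite /= (le_trans (HC i))// ltW.
move=> p clp; have [->|p0] := eqVneq p 0; first by left.
have p20 : 0 < `|p| / 2 by rewrite divr_gt0// normr_gt0.
have : closed (v @` [set i | `|p| / 2 < `|v i|]).
  apply: compact_closed; first exact: norm_hausdorff.
  exact/finite_compact/finite_image/v0.
move=> /(_ p); case=> [V nV|i _ <-]; last by right; exists i.
have := clp (V `&` ball p (`|p| / 2)) (filterI nV (nbhsx_ballx _ _ p20)).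
rewrite -ball_normE => -[q [Bq [Vq /= pq]]]; exists q; split=> //.
have qp : `|p| / 2 < `|q|.
  have := ler_distD q p 0; rewrite !subr0. lra.
case: Bq qp Vq => [->|[i _ <-]]; last by exists i.
by rewrite normr0 ltNge ltW.
Qed.

Section compact_representation.
Context (R : realType) (I : choiceType) (N : nat) (v : I -> 'rV[R]_N).
Hypothesis v0 : vanishing v.

Let B : set 'rV[R]_N := [set 0] `|` range v.
(** The parameters carry vectors of [B] instead of indices: an infinite discrete index set is not
    compact, whereas [B], which contains the limit value 0, is. *)
Let T : topologicalType := prod_topology (fun _ : 'I_N => (R * 'rV[R]_N)%type).
Let comb (p : T) : 'rV[R]_N := \sum_j (p j).1 *: (p j).2.
Let cost (p : T) : R := \sum_j `|(p j).1|.
Let K (c : R) : set T := [set p | (forall j, B (p j).2) /\ cost p <= c].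

Let coord_cvg (p : T) j : (q j) @[q --> p] --> p j.
Proof. exact: (@proj_continuous _ (fun _ : 'I_N => (R * 'rV[R]_N)%type) j p). Qed.

Let coef_continuous j : continuous (fun p : T => (p j).1).
Proof.
move=> p; have h : fst x @[x --> p j] --> (p j).1.
  by case: (p j) => a b; exact: (@cvg_fst _ _ (nbhs a) (nbhs b)).
exact: cvg_comp (@coord_cvg p j) h.
Qed.

Let vec_continuous j : continuous (fun p : T => (p j).2).
Proof.
move=> p; have h : snd x @[x --> p j] --> (p j).2.
  by case: (p j) => a b; exact: (@cvg_snd _ _ (nbhs a) (nbhs b)).
exact: cvg_comp (@coord_cvg p j) h.
Qed.

Let comb_continuous : continuous comb.
Proof.
apply: continuous_big => [|j _ p]; first exact: add_continuous.
exact: (continuousZ (@coef_continuous j p) (@vec_continuous j p)).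
Qed.

Let cost_continuous : continuous cost.
Proof.
apply: continuous_big => [|j _ p]; first exact: add_continuous.
exact: (continuous_comp (@coef_continuous j p) (@norm_continuous _ _ _)).
Qed.

(** A closed subset of a product of copies of [[-c, c]] times [B], which is compact by Tychonoff's
    theorem. *)
Let K_compact c : compact (K c).
Proof.
have clc : closed [set p | cost p <= c].
  apply: (preimage_closed _ (@closed_le _ c)) => p _; exact: cost_continuous.
have cB := @tychonoff _ (fun _ : 'I_N => (R * 'rV[R]_N)%type)
  (fun=> `[- c, c]%classic `*` B)
  (fun=> compact_setX (@segment_compact _ _ _) (vanishing_compact v0)).
apply: (subclosed_compact _ cB).
- rewrite (_ : K c = [set p | cost p <= c] `&`
      \bigcap_(j in [set: 'I_N]) [set p : T | B (p j).2]); last first.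
    apply/seteqP; split => p [pB pc]; split => // j; first by move=> _; exact: pB.
    exact: (pc j).
  apply: closedI => //; apply: closed_bigI => j _.
  apply: (@preimage_closed _ _ (fun p : T => (p j).2) B).
    by move=> p _; exact: vec_continuous.
  by apply: compact_closed; [exact: norm_hausdorff|exact: vanishing_compact].
- move=> p [Bp cp] j; split; last exact: Bp.
  rewrite /= in_itv/= -ler_norml (le_trans _ cp)// /cost (bigD1 j)//=.
  by rewrite lerDl sumr_ge0.
Qed.

Let K_finite_sum (S : set I) (a : I -> R) (c : R) : finite_set S ->
  \sum_(i \in S) `|a i| <= c -> (comb @` K c) (\sum_(i \in S) a i *: v i).
Proof.
move=> fS; rewrite !fsbig_finite//=.
set s : seq I := finmap.enum_fset (fset_set S) => ac.
have [w [b [Bw bw ba]]] := @caratheodory_l1 R N _ B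
  (fun i => v (tnth (in_tuple s) i)) (fun i => a (tnth (in_tuple s) i))
  (or_introl erefl) (fun i => or_intror (imageT v _)).
exists (fun j => (b j, w j)).
  split=> //=; apply: le_trans ba _.
  by rewrite -(big_tnth _ _ s xpredT (fun i => `|a i|)).
by rewrite /comb bw -(big_tnth _ _ s xpredT (fun i => a i *: v i)).
Qed.

(** With [c] the l1 norm of [a], the finite partial sums lie in the image of [K c] by Caratheodory;
    they approach the full sum, and the image is compact, hence closed. *)
Lemma mixture_representation (a : I -> R) : l1 a ->
  exists (b : 'I_N -> R) (w : 'I_N -> 'rV[R]_N),
    [/\ forall j, B (w j),
        \sum_j b j *: w j = \row_k sum_family (fun i => a i * v i ord0 k)
      & ((\sum_j `|b j|)%:E <= l1norm a)%E].
Proof.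
move=> a1; set y := \row_k _.
have afin : l1norm a \is a fin_num.
  by rewrite ge0_fin_numE//; apply: esum_ge0 => i _; rewrite lee_fin.
suff [p [Bp cp] py] : (comb @` K (fine (l1norm a))) y.
  exists (fun j => (p j).1), (fun j => (p j).2); split => //.
  by rewrite -(fineK afin) lee_fin.
have [C HC] := vanishing_bounded v0.
have : closed (comb @` K (fine (l1norm a))).
  apply: compact_closed; first exact: norm_hausdorff.
  apply: continuous_compact; last exact: K_compact.
  exact: continuous_subspaceT.
apply => V /nbhs_ballP[e /= e0 eV].
have l1k k : l1 (fun i => a i * v i ord0 k).
  apply: (l1_bounded_mul (C := `|C|) a1) => i.
  apply: le_trans (le_trans (HC i) (ler_norm _)).
  by rewrite [leRHS]/Num.Def.normr/= mx_normrE; apply/bigmax_geP; right; exists (ord0, k).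
have e20 : 0 < e / 2 by rewrite divr_gt0.
pose F k := projT1 (cid2 (sum_family_approx (l1k k) e20)).
have fF k : finite_set (F k) by rewrite /F; case: cid2.
(* One finite set for all coordinates, which suffices because R^N carries the maximum norm. *)
pose S := \bigcup_(k in [set: 'I_N]) F k.
have fS : finite_set S by apply: bigcup_finite => //; exact: finite_finset.
exists (\sum_(i \in S) a i *: v i); split.
  apply: K_finite_sum => //.
  rewrite -lee_fin fineK// -fsumEFin//; apply: ereal_sup_ubound.
  by exists S => //; split.
apply: eV; rewrite -ball_normE /= (@le_lt_trans _ _ (e / 2))//; last lra.
rewrite [leLHS]/Num.Def.normr/= mx_normrE; apply/bigmax_leP; split; first exact: ltW.
move=> [i k] _ /=; rewrite !mxE !ord1 fsbig_finite// summxE.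
rewrite (eq_bigr (fun i => a i * v i ord0 k)); last by move=> l _; rewrite mxE.
rewrite -fsbig_finite//.
have : F k `<=` S by move=> l Fl; exists k.
by rewrite /F; case: cid2 => /= A fA + AS; apply.
Qed.

(** Every [a] at least as good as a fixed [a0] is matched by a parameter in one compact set, on
    which the lower semicontinuous cost has a minimizer; the vectors of that minimizer are then
    traded for actual values of [v]. *)
Lemma sparse_minimizer (i0 : I) (G : 'rV[R]_N -> \bar R) (mu : R) :
  (forall y, (0 <= G y)%E) -> lower_semicontinuous G -> 0 < mu ->
  exists (b : 'I_N -> R) (l : 'I_N -> I), forall a, l1 a ->
    (G (\sum_j b j *: v (l j))%R + (mu * \sum_j `|b j|)%:E <=
     G (\row_k sum_family (fun i => a i * v i ord0 k)%R) + mu%:E * l1norm a)%E.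
Proof.
move=> G0 Glsc mu0.
pose obj a := (G (\row_k sum_family (fun i => a i * v i ord0 k)%R) +
  mu%:E * l1norm a)%E.
have [[a0 [a01 a0oo]]|none] := pselect (exists a, l1 a /\ (obj a < +oo)%E); last first.
  (* If no [a] has finite cost, the right-hand side is always [+oo] and any choice will do. *)
  exists (fun=> 0), (fun=> i0) => a a1.
  rewrite -/(obj a); suff -> : obj a = +oo%E by rewrite leey.
  by apply/eqP; rewrite -leye_eq leNgt; apply/negP => ao; apply: none; exists a.
have l1ge0 (a : I -> R) : (0 <= l1norm a)%E by apply: esum_ge0 => i _; rewrite lee_fin.
have o0 : obj a0 \is a fin_num.
  rewrite ge0_fin_numE//; apply: adde_ge0 => //; apply: mule_ge0 => //.
  by rewrite lee_fin ltW.
(* As [G >= 0], a cost of at most [obj a0] forces an l1 norm of at most [c]. *)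
pose c := fine (obj a0) / mu.
pose F p := (G (comb p) + (mu * cost p)%:E)%E.
have F0 p : (0 <= F p)%E.
  by apply: adde_ge0 => //; rewrite lee_fin mulr_ge0 ?sumr_ge0// ltW.
have lscF : lower_semicontinuous F.
  move=> p r; rewrite /F -lteBlDr// -EFinB => rG.
  (* The level [r] is split into [s] for the [G] term and [r - s] for the norm term, each strictly
     exceeded at [p] and therefore nearby. *)
  have [s rs sG] : exists2 s, r - mu * cost p < s & (s%:E < G (comb p))%E.
    move: rG; case: (G (comb p)) => [b||]//; rewrite ?lte_fin => rb.
    - by exists ((r - mu * cost p + b) / 2); rewrite ?lte_fin midf_lt.
    - by exists (r - mu * cost p + 1); rewrite ?ltrDl// ltry.
  have [V nV VG] := Glsc _ _ sG.
  exists (comb @^-1` V `&` [set q | r - s < mu * cost q]).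
    apply: filterI; first exact: comb_continuous.
    have cF : mu * cost q @[q --> p] --> mu * cost p.
      exact: (continuousM (@cst_continuous _ _ mu p) (@cost_continuous p)).
    have rsp : r - s < mu * cost p by lra.
    apply: (cF [set z | r - s < z]).
    by apply: open_nbhs_nbhs; split => //; exact: open_gt.
  move=> q [/VG Vq rq]; rewrite -lteBlDr// -EFinB (le_lt_trans _ Vq)// lee_fin.
  by move: rq => /=; lra.
have reach a : l1 a -> (obj a <= obj a0)%E -> exists2 p, K c p & (F p <= obj a)%E.
  move=> a1 aa0; have [b [w [Bw bw ba]]] := mixture_representation a1.
  exists (fun j => (b j, w j)).
    split=> //=; rewrite /cost/= ler_pdivlMr// -lee_fin fineK//.
    apply: le_trans aa0; rewrite /obj EFinM muleC.
    apply: (@le_trans _ _ (mu%:E * l1norm a)%E); last exact: leeDr.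
    by rewrite lee_pmul2l.
  rewrite /F /obj /comb /cost /= bw leeD2l// EFinM lee_pmul2l//.
have [p0 Kp0 Fp0] := reach _ a01 (lexx _).
have [p [Kp Fmin]] := lsc_compact_minimizer (@K_compact c)
  (ex_intro _ _ Kp0) F0 lscF.
have Fle a : l1 a -> (F p <= obj a)%E.
  move=> a1; have [aa0|/ltW a0a] := leP (obj a) (obj a0).
    by have [q Kq Fq] := reach _ a1 aa0; exact: le_trans (Fmin _ Kq) Fq.
  exact: le_trans (le_trans (Fmin _ Kp0) Fp0) a0a.
(* The vector 0 of [B] need not be a value of [v]; it is replaced by coefficient 0 at the arbitrary
   index [i0], which cannot raise the norm. *)
have pick j : exists bl : R * I,
    bl.1 *: v bl.2 = (p j).1 *: (p j).2 /\ `|bl.1| <= `|(p j).1|.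
  case: (Kp.1 j) => [->|[i _ <-]]; last by exists ((p j).1, i).
  by exists (0, i0); rewrite scale0r scaler0 normr0.
have {pick}[f Hf] := choice pick.
exists (fun j => (f j).1), (fun j => (f j).2) => a a1.
apply: le_trans (Fle _ a1); rewrite /F /comb.
rewrite (eq_bigr (fun j => (p j).1 *: (p j).2)) => [|j _]; last exact: (Hf j).1.
rewrite leeD2l// lee_fin ler_pM2l//; apply: ler_sum => j _; exact: (Hf j).2.
Qed.

End compact_representation.

(** * Reduction to the atoms *)

(** The indices [l j] may coincide, so a sum over [j] is regrouped along the fibres of [l]. *)
Lemma fsum_range_fiber (R : realType) (I : choiceType) (K : nat) (l : 'I_K -> I)
    (F : 'I_K -> I -> R) :
  \sum_(i \in range l) \sum_(j | l j == i) F j i = \sum_j F j (l j).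
Proof.
have fl : finite_set (range l) by apply: finite_image; exact: finite_finset.
rewrite fsbig_finite//= (exchange_big_dep predT)//=; apply: eq_bigr => j _.
rewrite (eq_bigl (pred1 (l j))); last by move=> i; rewrite /= eq_sym.
rewrite -big_filter filter_pred1_uniq ?finmap.fset_uniq ?big_seq1//.
by rewrite in_fset_set// inE; exists j.
Qed.

(** The coefficients of equal atoms are added up; by the triangle inequality this can only decrease
    the l1 norm. *)
Lemma U_norm_atomic_sum_le (R : realType) (d : nat) (nu : R -> R) (s : R)
    (K : nat) (a : 'I_K -> R) (l : 'I_K -> wavelet_index d) :
  (U_norm nu s (atomic_sum nu s a l) <= (\sum_j `|a j|)%:E)%E.
Proof.
have fl : finite_set (range l) by apply: finite_image; exact: finite_finset.
pose c i := \sum_(j | l j == i) a j.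
have c0 i : ~ range l i -> c i = 0.
  by move=> li; rewrite /c big1// => j /eqP lj; exfalso; apply: li; exists j.
have cle : (l1norm c <= (\sum_j `|a j|)%:E)%E.
  rewrite /l1norm (_ : esum _ _ = \esum_(i in range l) (`|c i|)%:E)%E; last first.
    rewrite [RHS]esum_mkcond; apply: eq_esum => i _.
    by case: ifPn => //; rewrite notin_setE => /c0 ->; rewrite normr0.
  rewrite esum_fset//.
  rewrite fsumEFin// lee_fin -(fsum_range_fiber l (fun j _ => `|a j|)).
  by rewrite !fsbig_finite//; apply: ler_sum => i _; exact: ler_norm_sum.
apply: (le_trans _ cle); apply: ereal_inf_lbound; exists c => //; split.
  by rewrite /l1/= (le_lt_trans cle)// ltry.
apply/funext => x; rewrite /synthesis (sum_family_finite fl).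
  rewrite /atomic_sum -(fsum_range_fiber l (fun j i => a j * atom nu s i x)).
  by apply: eq_fsbigr => i _; rewrite /c mulr_suml.
by move=> i /c0 ->; rewrite mul0r.
Qed.

Section representer.
Context (R : realType) (d : nat) (nu : R -> R) (s mu : R) (N : nat).
Context (x : 'I_N -> 'rV[R]_d) (G : 'rV[R]_N -> \bar R) (A : set ('rV[R]_d -> R)).
Hypothesis atom0 : vanishing (fun l => samples x (@atom R d nu s l)).
Hypothesis atomic_A : forall K (a : 'I_K -> R) (l : 'I_K -> wavelet_index d),
  A (atomic_sum nu s a l).
Hypothesis G0 : forall y, (0 <= G y)%E.
Hypothesis Glsc : lower_semicontinuous G.
Hypothesis mu0 : 0 < mu.

Let J := objective nu s mu x G.
Let JK K := discrete_objective nu s mu x G (K := K).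

Let J_atomic_sum_le K p : (J (atomic_sum nu s p.1 p.2) <= @JK K p)%E.
Proof.
rewrite /J /JK /objective /discrete_objective leeD2l// EFinM lee_pmul2l//.
exact: U_norm_atomic_sum_le.
Qed.

Let exists_sparse : exists p : ('I_N -> R) * ('I_N -> wavelet_index d),
  forall f, (JK p <= J f)%E.
Proof.
have [b [l bl]] := sparse_minimizer atom0 (inl 0) G0 Glsc mu0.
exists (b, l) => f; rewrite /JK /J /objective /discrete_objective /=.
have [->|Uoo] := eqVneq (U_norm nu s f) +oo%E.
  rewrite gt0_muley ?lte_fin// addey ?leey//.
  by apply: contraTneq (G0 (samples x f)) => ->.
have [G_oo|Goo] := eqVneq (G (samples x f)) +oo%E.
  rewrite G_oo addye ?leey// gt_eqF// (lt_le_trans ltNy0)// mule_ge0//.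
    by rewrite lee_fin ltW.
  apply: le_ereal_inf_tmp => _ [a _ <-].
  by apply: esum_ge0 => i _; rewrite lee_fin.
have Gfin : G (samples x f) \is a fin_num by rewrite ge0_fin_numE// ltey.
(* [G] being finite here, it is moved to the other side, so that the inequality is checked for each
   [a] in the infimum defining [U_norm]. *)
rewrite -leeBlDl// -lee_pdivrMl//; apply: le_ereal_inf_tmp => _ [a [a1 af] <-].
rewrite lee_pdivrMl// leeBlDl//.
have := bl a a1; rewrite (_ : \row_k _ = samples x f); last first.
  by apply/rowP => k; rewrite !mxE -af /synthesis; congr sum_family;
    apply/funext => i; rewrite mxE.
apply: le_trans; rewrite leeD2r//.
rewrite (_ : samples x _ = \sum_j b j *: samples x (atom nu s (l j)))//.
apply/rowP => k; rewrite summxE mxE /atomic_sum; apply: eq_bigr => j _.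
by rewrite !mxE.
Qed.

(** All claims follow from [JK p0 <= J f] for every [f] and [J f <= JK p] for [f] the atomic sum of
    [p]: no parameter of any length beats [p0], and any [p] with [JK p <= JK p0] yields a minimizer
    of [J]. *)
Lemma sparse_representer :
  let solP := minimizer A J in
  let solK K := minimizer setT (@JK K) in
  (exists f, solP f) /\
  (exists (K : nat) (a : 'I_K -> R) (l : 'I_K -> wavelet_index d),
     (K <= N)%N /\ solP (atomic_sum nu s a l)) /\
  (forall K : nat, (N <= K)%N ->
     (exists p, solK K p) /\
     (forall p, solK K p -> solP (atomic_sum nu s p.1 p.2))).
Proof.
move=> solP solK; have [p0 p0J] := exists_sparse.
have JKge K p : (JK p0 <= @JK K p)%E := le_trans (p0J _) (J_atomic_sum_le p).
have solPK K (p : ('I_K -> R) * ('I_K -> wavelet_index d)) :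
    (JK p <= JK p0)%E -> solP (atomic_sum nu s p.1 p.2).
  move=> pp0; split=> [|f _]; first exact: atomic_A.
  exact: le_trans (J_atomic_sum_le p) (le_trans pp0 (p0J f)).
split; first by exists (atomic_sum nu s p0.1 p0.2); exact: solPK.
split; first by exists N, p0.1, p0.2; split => //; exact: solPK.
move=> K NK.
(* [p0] is extended to length [K] by zero coefficients at the arbitrary index [inl 0]. *)
pose p : ('I_K -> R) * ('I_K -> wavelet_index d) :=
  (fun j => oapp p0.1 0 (insub (nat_of_ord j)),
   fun j => oapp p0.2 (inl 0) (insub (nat_of_ord j))).
have pE (F : R -> wavelet_index d -> R) : (forall l, F 0 l = 0) ->
    \sum_(j < K) F (p.1 j) (p.2 j) = \sum_(j < N) F (p0.1 j) (p0.2 j).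
  move=> F0; pose g k := F (oapp p0.1 0 (insub k)) (oapp p0.2 (inl 0) (insub k)).
  rewrite [RHS](_ : _ = \sum_(j < N) g j); last first.
    by apply: eq_bigr => j _; rewrite /g valK.
  rewrite (big_ord_widen K g NK) [RHS]big_mkcond /=; apply: eq_bigr => j _.
  by case: ifPn => // jN; rewrite insubF ?F0//; exact: negbTE.
have JKp : JK p = JK p0.
  rewrite /JK /discrete_objective (pE (fun a _ => `|a|)); last by rewrite normr0.
  congr (G _ + _)%E; apply/rowP => k; rewrite !mxE.
  by rewrite /atomic_sum (pE (fun a l => a * atom nu s l (x k)))// => l; rewrite mul0r.
split; first by exists p; split => // q _; rewrite JKp.
by move=> q [_ qmin]; apply: solPK; rewrite -JKp; exact: qmin.
Qed.

End representer.

(** * Differences of tensor products *)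

Section decay.
Context (R : realType).
Implicit Types f g : R -> R.

(** Domination by 1 / (1 + x^2) of the function and its first [n] derivatives. The derivative is an
    existential witness, so that inductions peel off one order at a time. *)
Fixpoint smooth_decay (n : nat) (f : R -> R) : Prop :=
  (exists C, forall x, `|f x| <= C * (oneDsqr x)^-1) /\
  (if n is m.+1 then
     exists f', (forall x, is_derive x (1 : R) f (f' x)) /\ smooth_decay m f'
   else True).

Lemma smooth_decay_bound n f : smooth_decay n f ->
  exists2 C, 0 <= C & forall x, `|f x| <= C * (oneDsqr x)^-1.
Proof.
case: n => [|n] [[C HC] _]; exists C => //;
  by have := le_trans (normr_ge0 _) (HC 0); rewrite pmulr_lge0 ?invr_gt0.
Qed.

Lemma smooth_decay_pred n f : smooth_decay n.+1 f -> smooth_decay n f.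
Proof.
elim: n f => [|n IH] f; first by case=> [Cf _]; split.
by case=> Cf [f' [ff' sf']]; split=> //; exists f'; split=> //; exact: IH.
Qed.

(** From x^2 <= 2 (x + u)^2 + 2 u^2, which is (x + 2 u)^2 >= 0, and u^2 <= 1. *)
Lemma oneDsqrV_shift (x u : R) : `|u| <= 1 ->
  (oneDsqr (x + u))^-1 <= 3 * (oneDsqr x)^-1.
Proof.
move=> u1; have u21 : u ^+ 2 <= 1 by rewrite -real_normK ?num_real// expr_le1.
rewrite ler_pdivlMr// mulrC ler_pdivrMr// /oneDsqr.
have := sqr_ge0 (x + 2 * u); nra.
Qed.

Definition tens (d : nat) (f : 'I_d -> R -> R) (x : 'rV[R]_d) : R :=
  \prod_i f i (x ord0 i).

(** An integrable weight on R^d, at most 1, and multiplied by at most 3^d under shifts with entries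
    in [-1, 1]. *)
Definition decay_weight (d : nat) : 'rV[R]_d -> R :=
  tens (fun _ y => (oneDsqr y)^-1).

(** With [g] the derivative of [f i], [tens (upd f i g)] is the i-th partial derivative of
    [tens f]. *)
Definition upd (d : nat) (f : 'I_d -> R -> R) (i : 'I_d) (g : R -> R) :=
  fun j => if j == i then g else f j.

Lemma decay_weight_gt0 d (x : 'rV[R]_d) : 0 < decay_weight x.
Proof. by apply: prodr_gt0 => i _; rewrite invr_gt0. Qed.

Lemma decay_weight_le1 d (x : 'rV[R]_d) : decay_weight x <= 1.
Proof. by apply: Num.Theory.prodr_ile1 => i _; rewrite invr_ge0 ltW//= oneDsqrV_le1. Qed.

Lemma decay_weight_shift d (x u : 'rV[R]_d) : (forall i, `|u ord0 i| <= 1) ->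
  decay_weight (x + u) <= 3 ^+ d * decay_weight x.
Proof.
move=> u1; rewrite /decay_weight /tens.
rewrite -[X in 3 ^+ X](card_ord d) -prodr_const -big_split/=.
by apply: ler_prod => i _; rewrite invr_ge0 ltW//= mxE oneDsqrV_shift.
Qed.

Lemma tens_bound n d (f : 'I_d -> R -> R) : (forall i, smooth_decay n (f i)) ->
  exists2 C, 0 <= C & forall x, `|tens f x| <= C * decay_weight x.
Proof.
move=> sf; have /choice[C HC] : forall i, exists C, 0 <= C /\
    forall x, `|f i x| <= C * (oneDsqr x)^-1.
  by move=> i; have [C C0 HC] := smooth_decay_bound (sf i); exists C.
exists (\prod_i C i) => [|x]; first by apply: prodr_ge0 => i _; exact: (HC i).1.
rewrite /decay_weight /tens normr_prod -big_split/=.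
by apply: ler_prod => i _; rewrite normr_ge0; exact: (HC i).2.
Qed.

Lemma is_derive_prod d (F : 'I_d -> R -> R) (F' : 'I_d -> R) (t : R) :
  (forall i, is_derive t (1 : R) (F i) (F' i)) ->
  is_derive t (1 : R) (fun t => \prod_i F i t)
    (\sum_i \prod_j (if j == i then F' j else F j t)).
Proof.
elim: d F F' => [|d IH] F F' HF.
  rewrite big_ord0; under eq_fun do rewrite big_ord0.
  exact: is_derive_cst.
have := @is_deriveM _ _ (F ord0) (fun t => \prod_(i < d) F (lift ord0 i) t)
  t 1 _ _ (HF ord0) (IH _ _ (fun i => HF (lift ord0 i))).
rewrite (_ : _ * _ = fun t => \prod_i F i t); last first.
  by apply/funext => u; rewrite big_ord_recl.
move=> H; apply: is_derive_eq H _.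
rewrite [RHS]big_ord_recl /= big_ord_recl eqxx addrC; congr (_ + _).
  by rewrite [LHS]mulrC; congr (_ * _); apply: eq_bigr => i _.
rewrite [LHS]mulr_sumr; apply: eq_bigr => i _.
rewrite [RHS]big_ord_recl; by congr (_ * _); apply: eq_bigr => j _.
Qed.

Lemma is_derive_line f (a b t f' : R) : is_derive (a + t * b) (1 : R) f f' ->
  is_derive t (1 : R) (fun t => f (a + t * b)) (b * f').
Proof.
move=> ff'; have H : is_derive t (1 : R) (fun t : R => a + t * b) b.
  have -> : (fun t : R => a + t * b) = cst a + b \*: id.
    by apply/funext => u; rewrite /= mulrC.
  by apply: is_derive_eq; rewrite add0r [LHS]mulr1.
have := @is_derive1_comp R f (fun t => a + t * b) t f' b ff' H.
by rewrite mulrC.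
Qed.

Definition tens_diff d (f f' : 'I_d -> R -> R) (h : 'rV[R]_d) (x : 'rV[R]_d) : R :=
  \sum_i h ord0 i * tens (upd f i (f' i)) x.

Lemma is_derive_tens_line d (f f' : 'I_d -> R -> R) (x h : 'rV[R]_d) (t : R) :
  (forall i y, is_derive y (1 : R) (f i) (f' i y)) ->
  is_derive t (1 : R) (fun t => tens f (x + t *: h))
    (tens_diff f f' h (x + t *: h)).
Proof.
move=> ff'.
have := @is_derive_prod d (fun i t => f i (x ord0 i + t * h ord0 i))
  (fun i => h ord0 i * f' i (x ord0 i + t * h ord0 i)) t
  (fun i => is_derive_line (ff' i _)).
rewrite (_ : (fun t => \prod_i _) = fun t => tens f (x + t *: h)); last first.
  by apply/funext => u; apply: eq_bigr => i _; rewrite !mxE.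
move=> H; apply: is_derive_eq H _; apply: eq_bigr => i _.
rewrite /tens /upd (bigD1 i)//= [in RHS](bigD1 i)//= !eqxx !mxE mulrA.
congr (_ * _); apply: eq_bigr => j ji.
by rewrite !mxE (negbTE ji).
Qed.

Section line.
Context (d : nat) (h : 'rV[R]_d).

(** Differencing commutes with differentiating along [h], so the mean value theorem applies to an
    iterated difference. *)
Lemma is_derive_iter_fdiff n (F F' : 'rV[R]_d -> R) :
  (forall x t, is_derive t (1 : R) (fun t => F (x + t *: h)) (F' (x + t *: h))) ->
  forall x t, is_derive t (1 : R) (fun t => iter n (fdiff h) F (x + t *: h))
    (iter n (fdiff h) F' (x + t *: h)).
Proof.
move=> FF'; elim: n => [//|n IH] x t /=.
have := is_deriveB (IH (x + h) t) (IH x t).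
rewrite (_ : _ - _ = fun t => fdiff h (iter n (fdiff h) F) (x + t *: h)).
  by rewrite [in fdiff h _ _]/fdiff addrAC.
by apply/funext => u; rewrite /fdiff [in RHS]addrAC.
Qed.

Lemma MVT_line (F F' : 'rV[R]_d -> R) (x : 'rV[R]_d) :
  (forall x t, is_derive t (1 : R) (fun t => F (x + t *: h)) (F' (x + t *: h))) ->
  exists2 c : R, 0 <= c <= 1 & F (x + h) - F x = F' (x + c *: h).
Proof.
move=> FF'; pose g t := F (x + t *: h).
have cg : {within `[0, 1], continuous g}.
  by apply: derivable_within_continuous => t _; exact: ex_derive.
have [c] := MVT ltr01 (fun t _ => FF' x t) cg.
rewrite in_itv/= /g => /andP[c0 c1]; rewrite scale1r scale0r addr0 subr0 mulr1.
by exists c => //; rewrite !ltW.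
Qed.

Lemma iter_fdiff_sum n (I : finType) (k : I -> R) (F : I -> 'rV[R]_d -> R) :
  iter n (fdiff h) (fun x => \sum_i k i * F i x) =
  (fun x => \sum_i k i * iter n (fdiff h) (F i) x).
Proof.
elim: n => [//|n IH] /=; rewrite IH; apply/funext => x.
by rewrite /fdiff -sumrB; apply: eq_bigr => i _; rewrite mulrBr.
Qed.

End line.

Lemma smooth_decay_upd n d (f f' : 'I_d -> R -> R) i :
  (forall i, smooth_decay n.+1 (f i)) -> smooth_decay n (f' i) ->
  forall j, smooth_decay n (upd f i (f' i) j).
Proof.
by move=> sf sf' j; rewrite /upd; case: ifP => // _; exact/smooth_decay_pred.
Qed.

Lemma smooth_decay_derivatives n d (f : 'I_d -> R -> R) :
  (forall i, smooth_decay n.+1 (f i)) ->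
  exists f' : 'I_d -> R -> R,
    (forall i y, is_derive y (1 : R) (f i) (f' i y)) /\
    (forall i, smooth_decay n (f' i)).
Proof.
move=> sf.
have /choice[f' Hf'] : forall i, exists f' : R -> R,
    (forall y, is_derive y (1 : R) (f i) (f' y)) /\ smooth_decay n f'.
  by move=> i; case: (sf i) => _.
by exists f'; split=> i; [exact: (Hf' i).1|exact: (Hf' i).2].
Qed.

Lemma tens_lipschitz d (f : 'I_d -> R -> R) : (forall i, smooth_decay 1 (f i)) ->
  exists2 C, 0 <= C & forall x y, `|tens f x - tens f y| <= C * `|x - y|.
Proof.
move=> sf; have [f' [ff' sf']] := smooth_decay_derivatives sf.
have /choice[C HC] : forall i, exists C, 0 <= C /\
    forall x, `|tens (upd f i (f' i)) x| <= C * decay_weight x.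
  move=> i; have [C C0 HC] := tens_bound (smooth_decay_upd sf (sf' i)).
  by exists C.
exists (\sum_i C i) => [|x y]; first by apply: sumr_ge0 => i _; exact: (HC i).1.
pose h := x - y.
have [c _] := MVT_line y (fun x t => is_derive_tens_line x h t ff').
rewrite (_ : y + h = x) ?[in y + _]addrC ?subrK// => ->.
apply: le_trans (ler_norm_sum _ _ _) _; rewrite mulr_suml.
apply: ler_sum => i _; rewrite normrM mulrC ler_pM//.
  apply: le_trans ((HC i).2 _) _.
  by rewrite ler_piMr ?decay_weight_le1//; exact: (HC i).1.
by rewrite [leRHS]/Num.Def.normr/= mx_normrE; apply/bigmax_geP; right; exists (ord0, i).
Qed.

(** By induction: the mean value theorem turns one difference into a derivative along [h] at an
    intermediate point [x + c h]. The entries of [h] give a factor [e], and moving the weight from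
    [x + c h] back to [x] costs 3^d. *)
Lemma tens_fdiff_bound n d (f : 'I_d -> R -> R) :
  (forall i, smooth_decay n (f i)) ->
  exists2 C, 0 <= C & forall (x h : 'rV[R]_d) (e : R),
    0 <= e <= 1 -> (forall i, `|h ord0 i| <= e) ->
    `|iter n (fdiff h) (tens f) x| <= C * e ^+ n * decay_weight x.
Proof.
elim: n f => [|n IH] f sf.
  have [C C0 HC] := tens_bound sf; exists C => // x h e _ _.
  by rewrite expr0 mulr1; exact: HC.
have [f' [ff' sf']] := smooth_decay_derivatives sf.
have /choice[C HC] : forall i, exists C, 0 <= C /\
    forall (x h : 'rV[R]_d) (e : R), 0 <= e <= 1 -> (forall i, `|h ord0 i| <= e) ->
    `|iter n (fdiff h) (tens (upd f i (f' i))) x| <= C * e ^+ n * decay_weight x.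
  move=> i; have [C C0 HC] := IH _ (smooth_decay_upd sf (sf' i)).
  by exists C.
exists ((\sum_i C i) * 3 ^+ d) => [|x h e e01 he].
  by rewrite mulr_ge0 ?exprn_ge0// sumr_ge0// => i _; exact: (HC i).1.
have /andP[e0 e1] := e01.
have [c /andP[c0 c1] cE] :=
  MVT_line x (is_derive_iter_fdiff n (fun x t => is_derive_tens_line x h t ff')).
rewrite iterS [X in `|X|]cE /tens_diff iter_fdiff_sum.
apply: le_trans (ler_norm_sum _ _ _) _.
rewrite exprSr -!mulrA !mulr_suml; apply: ler_sum => i _.
rewrite normrM; apply: (@le_trans _ _ (e * (C i * e ^+ n * decay_weight (x + c *: h)))).
  by apply: ler_pM => //; exact: (HC i).2.
rewrite [leRHS](_ : _ = e * (C i * e ^+ n * (3 ^+ d * decay_weight x))); last ring.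
rewrite ler_wpM2l// ler_wpM2l ?mulr_ge0 ?exprn_ge0 ?(HC i).1//.
apply: decay_weight_shift => j.
rewrite mxE normrM ger0_norm// mulr_ile1//; exact: le_trans (he j) e1.
Qed.

End decay.

(** * Integrals and membership in the Besov space *)

(** The integral of a nonnegative function is a supremum over simple functions below it, so
    monotonicity extends to non-measurable integrands. It is applied to the modulus of smoothness,
    an uncountable supremum. *)
Lemma ge0_le_integralW d (T : measurableType d) (R : realType)
    (mu : {measure set T -> \bar R}) (D : set T) (f g : T -> \bar R) :
  (forall x, D x -> (0 <= f x)%E) -> (forall x, D x -> (f x <= g x)%E) ->
  (\int[mu]_(x in D) f x <= \int[mu]_(x in D) g x)%E.
Proof.
move=> f0 fg; have g0 x : D x -> (0 <= g x)%E.
  by move=> Dx; exact: le_trans (f0 _ Dx) (fg _ Dx).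
rewrite !ge0_integralE//; apply: ereal_sup_le => _ [h hf <-].
exists h => // x; apply: le_trans (hf x) _.
by rewrite /patch; case: ifPn => // /set_mem; exact: fg.
Qed.

Lemma integral_oneDsqrV_fin (R : realType) :
  (\int[@lebesgue_measure R]_x ((oneDsqr x)^-1)%:E < +oo)%E.
Proof.
rewrite ge0_symfun_integralT.
- rewrite (_ : [set x | _] = `[0, +oo[%classic); last first.
    by apply/seteqP; split => x/=; rewrite in_itv/= andbT.
  by rewrite integral0y_oneDsqr -EFinM ltry.
- by move=> x; rewrite invr_ge0.
- exact: continuous_oneDsqrV.
- by move=> x; rewrite /oneDsqr/= sqrrN.
Qed.

Lemma measurable_tens (R : realType) d (f : 'I_d -> R -> R) :
  (forall i, continuous (f i)) ->
  measurable_fun [set: d.-tuple (measurableTypeR R)]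
    (fun v => tens f (row_of_tuple v) : measurableTypeR R).
Proof.
move=> cf; apply: (@measurable_prod _ _ R setT _ _
  (fun i (v : d.-tuple (measurableTypeR R)) => f i (row_of_tuple v ord0 i))) => i _.
rewrite (_ : (fun _ => _) = f i \o (fun v : d.-tuple (measurableTypeR R) => tnth v i)).
  apply: measurableT_comp; last exact: measurable_tnth.
  exact: continuous_measurable_fun.
by apply/funext => v; rewrite /= mxE.
Qed.

(** Tonelli and induction on the dimension: the weight is a function of the first coordinate times
    the weight of the others. *)
Lemma integral_decay_weight_fin (R : realType) d :
  (\int[lebesgue_tuple R d]_v (decay_weight (row_of_tuple v))%:E < +oo)%E.
Proof.
elim: d => [|d IH].
  under eq_integral do rewrite /decay_weight /tens big_ord0.
  by rewrite integral_cst//= mul1e diracE mem_set// ltry.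
have mW n : measurable_fun [set: n.-tuple (measurableTypeR R)]
    (fun v => (decay_weight (row_of_tuple v))%:E).
  by apply/measurable_EFinP; apply: measurable_tens => _; exact: continuous_oneDsqrV.
have W0 n (v : n.-tuple (measurableTypeR R)) :
    (0 <= (decay_weight (row_of_tuple v))%:E)%E.
  by rewrite lee_fin ltW// decay_weight_gt0.
rewrite (eq_measure_integral (pushforward
  (@lebesgue_measure R \x lebesgue_tuple R d)%E (@cons_pair R d))) => [|mcons|//].
  exact: measurable_cons_pair.
rewrite ge0_integral_pushforward//.
rewrite preimage_setT.
rewrite [X in (\int[_]_(p in _) X p)%E](_ : _ = fun p =>
    (((oneDsqr p.1)^-1)%:E * (decay_weight (row_of_tuple p.2))%:E)%E); last first.
  apply/funext => -[y v] /=; rewrite -EFinM /decay_weight /tens big_ord_recl.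
  rewrite /row_of_tuple mxE tnth0; congr (_ * _)%:E.
  by apply: eq_bigr => i _; rewrite !mxE tnthS.
rewrite fubini_tonelli1/=; first last.
- by move=> p; rewrite mule_ge0// lee_fin invr_ge0.
- apply: emeasurable_funM.
    have mq : measurable_fun [set: R] (fun y : R => (oneDsqr y)^-1).
      by apply: continuous_measurable_fun; exact: continuous_oneDsqrV.
    by apply/measurable_EFinP; exact: (measurableT_comp mq measurable_fst).
  exact: (measurableT_comp (mW d) measurable_snd).
rewrite /fubini_F/=.
under eq_integral.
  move=> y _; rewrite ge0_integralZl//; last exact: (mW d).
  over.
rewrite ge0_integralZr//; first last.
- exact: integral_ge0.
- apply/measurable_EFinP; apply: continuous_measurable_fun.
  exact: continuous_oneDsqrV.
- rewrite lte_mul_pinfty ?integral_oneDsqrV_fin//.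
  + by apply: integral_ge0 => y _; rewrite lee_fin invr_ge0.
  + rewrite ge0_fin_numE//; first exact: integral_oneDsqrV_fin.
    by apply: integral_ge0 => y _; rewrite lee_fin invr_ge0.
exact: mW.
Qed.

(** For [b < 1] the integrand is unbounded at 0, so ]0, 1] is exhausted by intervals away from 0,
    where t^b / b is an antiderivative. *)
Lemma integral_powR_unit (R : realType) (b : R) : 0 < b ->
  (\int[@lebesgue_measure R]_(t in `]0%R, 1%R]) (t `^ (b - 1))%:E <= (b^-1)%:E)%E.
Proof.
(* [n.+2] keeps the left endpoint strictly below 1, already for [n = 0]. *)
move=> b0; pose F (n : nat) := `[(n.+2%:R^-1 : R), 1%R]%classic.
have bigF : `]0%R, 1%R]%classic = \bigcup_n F n.
  apply/seteqP; split => [t|t [n _]]; rewrite /F /= !in_itv/=.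
    case/andP => t0 t1; exists (Num.truncn t^-1) => //=; rewrite in_itv/= t1 andbT.
    rewrite invf_ple ?posrE// ltW//.
    have t0' : 0 <= t^-1 by rewrite invr_ge0 ltW.
    have /andP[_ /lt_le_trans] := Num.Theory.truncn_itv t0'; apply.
    by rewrite ler_nat.
  by case/andP => nt ->; rewrite andbT (lt_le_trans _ nt).
have mf : measurable_fun [set: R] (fun t : R => (t `^ (b - 1))%:E).
  by apply/measurable_EFinP; exact: measurable_powR.
rewrite bigF.
have F0 t : (0 <= (t `^ (b - 1))%:E)%E by rewrite lee_fin powR_ge0.
have ndF : nondecreasing_seq F.
  move=> n m nm; apply/subsetPset => t; rewrite /F/= !in_itv/= => /andP[nt ->].
  by rewrite andbT (le_trans _ nt)// lef_pV2 ?posrE// ler_nat.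
have cvgF := @ge0_nondecreasing_set_cvg_integral _ (measurableTypeR R) R F
  (fun t => (t `^ (b - 1))%:E)
  (@lebesgue_measure R) ndF (fun n => measurable_itv _)
  (fun n => measurable_funTS mf) (fun n t _ => F0 t).
rewrite -(cvg_lim _ cvgF)//; apply: lime_le; first by apply/cvg_ex; eexists; exact: cvgF.
apply: nearW => n.
have n0 : 0 < (n.+2%:R^-1 : R) by [].
have n1 : (n.+2%:R^-1 : R) < 1 by rewrite invf_lt1// ltr1n.
have dG (t : R) : 0 < t -> is_derive t (1:R) (fun t => b^-1 * t `^ b) (t `^ (b - 1)).
  move=> t0.
  have := is_deriveZ b^-1 (is_derive1_powR b t0).
  by move=> H; apply: is_derive_eq H _; rewrite /GRing.scale/= mulrA mulVf ?mul1r// gt_eqF.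
have cG (t : R) : 0 < t -> {for t, continuous (fun t : R => t `^ (b - 1))}.
  move=> t0; apply/differentiable_continuous/derivable1_diffP.
  exact: (@ex_derive _ _ _ _ _ _ _ (is_derive1_powR (b - 1) t0)).
rewrite (@continuous_FTC2 R _ (fun t => b^-1 * t `^ b)) //.
- by rewrite -EFinB lee_fin powR1 mulr1 gerBl mulr_ge0 ?powR_ge0// invr_ge0 ltW.
- apply: continuous_in_subspaceT => t; rewrite inE/= in_itv/= => /andP[nt _].
  by apply: cG; exact: lt_le_trans nt.
- have dc (t : R) : 0 < t -> {for t, continuous (fun t : R => b^-1 * t `^ b)}.
    move=> t0; apply/differentiable_continuous/derivable1_diffP.
    exact: (@ex_derive _ _ _ _ _ _ _ (dG _ t0)).
  split.
  + move=> t; rewrite in_itv/= => /andP[nt _].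
    by apply: ex_derive; apply: dG; exact: lt_trans nt.
  + by apply: cvg_at_right_filter; exact: dc.
  + by apply: cvg_at_left_filter; exact: dc.
- move=> t; rewrite in_itv/= => /andP[nt _]; rewrite derive1E.
  by have := dG t (lt_trans n0 nt) => ?; rewrite derive_val.
Qed.

Section besov_membership.
Context (R : realType) (d : nat).
Implicit Types F : 'rV[R]_d -> R.

(** A sufficient condition for Besov membership that, unlike being a tensor product, is stable under
    linear combinations. *)
Definition smooth_l1 (r : nat) F : Prop :=
  [/\ measurable_fun [set: d.-tuple (measurableTypeR R)]
        (fun v => F (row_of_tuple v) : measurableTypeR R),
      exists2 C, 0 <= C & forall x, `|F x| <= C * decay_weight x,
      exists2 C, 0 <= C & forall x h, norm2 h <= 1 ->
        `|iter r (fdiff h) F x| <= C * norm2 h ^+ r * decay_weight x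
    & exists2 C, 0 <= C & forall x y, `|F x - F y| <= C * `|x - y|].

Lemma norm2_ge_coord (h : 'rV[R]_d) i : `|h ord0 i| <= norm2 h.
Proof.
rewrite /norm2 -sqrtr_sqr ler_sqrt ?sumr_ge0// => [|j _]; last exact: sqr_ge0.
rewrite (bigD1 i)//= lerDl sumr_ge0// => j _; exact: sqr_ge0.
Qed.

Lemma smooth_decay_continuous n (f : R -> R) : smooth_decay n.+1 f -> continuous f.
Proof.
case=> _ [f' [ff' _]] x; apply/differentiable_continuous/derivable1_diffP.
exact: ex_derive.
Qed.

Lemma smooth_l1_tens r (f : 'I_d -> R -> R) : (0 < r)%N ->
  (forall i, smooth_decay r (f i)) -> smooth_l1 r (tens f).
Proof.
case: r => // r _ sf; split.
- by apply: measurable_tens => i; exact: smooth_decay_continuous (sf i).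
- exact: tens_bound sf.
- have [C C0 HC] := tens_fdiff_bound sf; exists C => // x h h1.
  apply: HC; last exact: norm2_ge_coord.
  by rewrite h1 andbT sqrtr_ge0.
- apply: tens_lipschitz => i; have {sf} := sf i.
  by elim: r (f i) => // r IH g sg; apply: IH; exact: smooth_decay_pred.
Qed.

Lemma smooth_l1_sum r K (a : 'I_K -> R) (F : 'I_K -> 'rV[R]_d -> R) :
  (forall j, smooth_l1 r (F j)) -> smooth_l1 r (fun x => \sum_j a j * F j x).
Proof.
move=> sF; split.
- apply: (@measurable_sum _ _ R setT _ _ (fun j (v : d.-tuple (measurableTypeR R)) =>
    a j * F j (row_of_tuple v))) => j.
  by apply: measurable_funM => //; case: (sF j).
- have /choice[C HC] : forall j, exists C, 0 <= C /\
      forall x, `|F j x| <= C * decay_weight x.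
    by move=> j; have [_ [C ? ?] _ _] := sF j; exists C.
  exists (\sum_j `|a j| * C j) => [|x].
    by apply: sumr_ge0 => j _; rewrite mulr_ge0//; exact: (HC j).1.
  apply: le_trans (ler_norm_sum _ _ _) _; rewrite mulr_suml.
  by apply: ler_sum => j _; rewrite normrM -mulrA ler_wpM2l//; exact: (HC j).2.
- have /choice[C HC] : forall j, exists C, 0 <= C /\ forall x h, norm2 h <= 1 ->
      `|iter r (fdiff h) (F j) x| <= C * norm2 h ^+ r * decay_weight x.
    by move=> j; have [_ _ [C ? ?] _] := sF j; exists C.
  exists (\sum_j `|a j| * C j) => [|x h h1].
    by apply: sumr_ge0 => j _; rewrite mulr_ge0//; exact: (HC j).1.
  rewrite iter_fdiff_sum; apply: le_trans (ler_norm_sum _ _ _) _; rewrite !mulr_suml.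
  apply: ler_sum => j _; rewrite normrM -!mulrA ler_wpM2l// mulrA.
  exact: (HC j).2.
- have /choice[C HC] : forall j, exists C, 0 <= C /\
      forall x y, `|F j x - F j y| <= C * `|x - y|.
    by move=> j; have [_ _ _ [C ? ?]] := sF j; exists C.
  exists (\sum_j `|a j| * C j) => [|x y].
    by apply: sumr_ge0 => j _; rewrite mulr_ge0//; exact: (HC j).1.
  rewrite -sumrB; apply: le_trans (ler_norm_sum _ _ _) _; rewrite mulr_suml.
  apply: ler_sum => j _; rewrite -mulrBr normrM -mulrA ler_wpM2l//.
  exact: (HC j).2.
Qed.

Let W := (\int[lebesgue_tuple R d]_v (decay_weight (row_of_tuple v))%:E)%E.

Let W_fin : W \is a fin_num.
Proof.
rewrite ge0_fin_numE; first exact: integral_decay_weight_fin.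
by apply: integral_ge0 => v _; rewrite lee_fin ltW// decay_weight_gt0.
Qed.

Let W_ge0 : 0 <= fine W.
Proof.
by apply: fine_ge0; apply: integral_ge0 => v _; rewrite lee_fin ltW// decay_weight_gt0.
Qed.

Lemma L1norm_le F C : 0 <= C -> (forall x, `|F x| <= C * decay_weight x) ->
  (L1norm F <= (C * fine W)%:E)%E.
Proof.
move=> C0 FC; rewrite EFinM fineK// -ge0_integralZl//; first last.
- by move=> v _; rewrite lee_fin ltW// decay_weight_gt0.
- by apply/measurable_EFinP; apply: measurable_tens => _; exact: continuous_oneDsqrV.
by apply: ge0_le_integralW => v _; rewrite ?lee_fin.
Qed.

(** On ]0, 1] the modulus is at most a constant times t^r, so the integrand is at most a constant
    times t^(r - s - 1), integrable because r > s. *)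
Lemma smooth_l1_besov r (s : R) F : s < r%:R -> smooth_l1 r F -> besov s r F.
Proof.
move=> sr [mF [C C0 HC] [D D0 HD] [L L0 HL]]; split=> //.
- rewrite /besov_norm lte_add_pinfty//.
    by rewrite (le_lt_trans (L1norm_le C0 HC))// ltry.
  have mod_le t : 0 <= t <= 1 -> (modulus r F t <= (D * t ^+ r * fine W)%:E)%E.
    case/andP=> t0 t1; apply: ge_ereal_sup => _ [h /= ht <-].
    have h0 : 0 <= norm2 h by exact: sqrtr_ge0.
    apply: L1norm_le => [|x]; first by rewrite mulr_ge0// exprn_ge0.
    apply: le_trans (HD x h (le_trans ht t1)) _.
    rewrite (ler_wpM2r (ltW (decay_weight_gt0 x)))// ler_wpM2l//.
    by rewrite lerXn2r ?nnegrE.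
  have mod_ge0 t : 0 <= t -> (0 <= modulus r F t)%E.
    move=> t0; apply: (@le_trans _ _ (L1norm (iter r (fdiff 0) F))).
      by apply: integral_ge0 => v _; rewrite lee_fin.
    apply: ereal_sup_ubound; exists 0 => //=; rewrite /norm2 big1 ?sqrtr0//.
    by move=> i _; rewrite mxE expr0n.
  have rs0 : 0 < r%:R - s by rewrite subr_gt0.
  apply: (@le_lt_trans _ _ ((D * fine W)%:E *
      \int[@lebesgue_measure R]_(t in `]0%R, 1%R]) (t `^ (r%:R - s - 1))%:E)%E).
    rewrite -ge0_integralZl//; first last.
    + by rewrite lee_fin mulr_ge0.
    + by move=> t _; rewrite lee_fin powR_ge0.
    + apply/measurable_EFinP; apply: measurable_funTS; exact: measurable_powR.
    apply: ge0_le_integralW => t; rewrite /= in_itv/= => /andP[t0 t1].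
      by apply: mule_ge0; [rewrite lee_fin divr_ge0 ?powR_ge0// ltW|exact/mod_ge0/ltW].
    apply: (@le_trans _ _ ((t `^ (- s) / t)%:E * (D * t ^+ r * fine W)%:E)%E).
      apply: lee_wpmul2l; first by rewrite lee_fin divr_ge0 ?powR_ge0// ltW.
      by apply: mod_le; rewrite t1 ltW.
    rewrite -!EFinM lee_fin [leRHS](_ : _ = t `^ (- s) / t * (D * t ^+ r * fine W))//.
    have tn0 : t != 0 by rewrite gt_eqF.
    rewrite -addrA powRD ?tn0 ?implybT// powRD ?tn0 ?implybT//.
    rewrite powR_mulrn ?ltW// [t `^ (- 1)]powRN powRr1 ?ltW//.
    ring.
  rewrite (@le_lt_trans _ _ ((D * fine W) * (r%:R - s)^-1)%:E)// ?ltry//.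
  rewrite [leRHS]EFinM lee_wpmul2l//; first by rewrite lee_fin mulr_ge0.
  exact: integral_powR_unit.
- apply: (@klipschitzW _ _ _ L).
    exact: (@globally_properfilter _ _ (0, 0)).
  by move=> [x y] _; exact: HL.
Qed.

End besov_membership.

(** * Decay of the Meyer functions *)

Section C2.
Context (R : realType).
Implicit Types f g u : R -> R.

(** The regularity consumed by two integrations by parts. *)
Definition C2 f : Prop := exists f1 f2 : R -> R,
  [/\ forall x, is_derive x (1 : R) f (f1 x),
      forall x, is_derive x (1 : R) f1 (f2 x) & continuous f2].

Lemma is_derive_continuous f f1 : (forall x, is_derive x (1 : R) f (f1 x)) ->
  continuous f.
Proof.
move=> ff1 x; apply/differentiable_continuous/derivable1_diffP; exact: ex_derive.
Qed.

Lemma C2_cst (c : R) : C2 (fun=> c).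
Proof.
exists (fun=> 0), (fun=> 0); split; [by move=> x; exact: is_derive_cst..|].
by move=> x; exact: cvg_cst.
Qed.

Lemma C2_id : C2 (fun x => x).
Proof.
exists (fun=> 1), (fun=> 0); split.
- by move=> x; exact: is_derive_id.
- by move=> x; exact: is_derive_cst.
- by move=> x; exact: cvg_cst.
Qed.

Lemma C2_add f g : C2 f -> C2 g -> C2 (fun x => f x + g x).
Proof.
move=> [f1 [f2 [df df1 cf]]] [g1 [g2 [dg dg1 cg]]].
exists (fun x => f1 x + g1 x), (fun x => f2 x + g2 x); split=> x.
- exact: is_deriveD.
- exact: is_deriveD.
- by apply: cvgD; [exact: cf|exact: cg].
Qed.

Lemma C2_mul f g : C2 f -> C2 g -> C2 (fun x => f x * g x).
Proof.
move=> [f1 [f2 [df df1 cf2]]] [g1 [g2 [dg dg1 cg2]]].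
have cf := is_derive_continuous df; have cf1 := is_derive_continuous df1.
have cg := is_derive_continuous dg; have cg1 := is_derive_continuous dg1.
exists (fun x => f x * g1 x + g x * f1 x),
  (fun x => (f x * g2 x + g1 x * f1 x) + (g x * f2 x + f1 x * g1 x)); split=> x.
- exact: is_deriveM.
- by apply: is_deriveD; exact: is_deriveM.
- by do 2 apply: cvgD; apply: cvgM; [exact: cf|exact: cg2|exact: cg1|exact: cf1|
    exact: cg|exact: cf2|exact: cf1|exact: cg1].
Qed.

Lemma C2_comp f u : C2 f -> C2 u -> C2 (fun x => f (u x)).
Proof.
move=> [f1 [f2 [df df1 cf2]]] [u1 [u2 [du du1 cu2]]].
have cu := is_derive_continuous du; have cu1 := is_derive_continuous du1.
have cf1 := is_derive_continuous df1.
exists (fun x => f1 (u x) * u1 x),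
  (fun x => f1 (u x) * u2 x + u1 x * (f2 (u x) * u1 x)); split=> x.
- exact: is_derive1_comp.
- have H : is_derive x (1 : R) (fun x => f1 (u x)) (f2 (u x) * u1 x).
    exact: is_derive1_comp.
  exact: is_deriveM.
- apply: cvgD; apply: cvgM; [|exact: cu2|exact: cu1|].
    exact: (continuous_comp (cu x) (cf1 (u x))).
  by apply: cvgM; [exact: (continuous_comp (cu x) (cf2 (u x)))|exact: cu1].
Qed.

Lemma C2_cos : C2 cos.
Proof.
exists (fun x => - sin x), (fun x => - cos x); split=> x.
- exact: is_derive_cos.
- exact: is_deriveN.
- by apply: cvgN; exact: continuous_cos.
Qed.

Lemma C2_sin : C2 sin.
Proof.
exists cos, (fun x => - sin x); split=> x.
- exact: is_derive_sin.
- exact: is_derive_cos.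
- by apply: cvgN; exact: continuous_sin.
Qed.

Lemma C2_affine f (a b : R) : C2 f -> C2 (fun x => f (a * x + b)).
Proof.
move=> Cf; apply: (C2_comp Cf); apply: C2_add; last exact: C2_cst.
by apply: C2_mul; [exact: C2_cst|exact: C2_id].
Qed.

End C2.

(** * Cosine and sine integrals over a bounded interval *)

Section trigonometric_integral.
Context (R : realType) (A : R).
Hypothesis A0 : 0 < A.
Implicit Types f g h k H : R -> R.
Local Notation mu := (@lebesgue_measure R).

Definition trig_integral k H (x : R) : R :=
  \int[mu]_(xi in `[- A, A]) (H xi * k (x * xi)).

Let integrable_cont f : continuous f -> mu.-integrable `[- A, A] (EFin \o f).
Proof.
move=> cf; apply: continuous_compact_integrable; first exact: segment_compact.
exact: continuous_subspaceT.
Qed.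

Let cont_kernel k (x : R) : continuous k -> continuous (fun xi => k (x * xi)).
Proof.
move=> ck xi; apply: (@continuous_comp _ _ _ (fun xi => x * xi) k); last exact: ck.
exact: mulrl_continuous.
Qed.

Let cont_mul f g : continuous f -> continuous g -> continuous (fun x => f x * g x).
Proof. by move=> cf cg x; apply: cvgM; [exact: cf|exact: cg]. Qed.

Lemma trig_integral_bound k H x : continuous H -> continuous k ->
  (forall y, `|k y| <= 1) ->
  `|trig_integral k H x| <= \int[mu]_(xi in `[- A, A]) `|H xi|.
Proof.
move=> cH ck k1.
have cHk := cont_mul cH (@cont_kernel k x ck).
have cn f : continuous f -> continuous (fun xi => `|f xi|).
  by move=> cf xi; apply: cvg_norm; exact: cf.
apply: le_trans (le_normr_Rintegral _ _) _ => //; first exact: integrable_cont.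
apply: le_Rintegral => //; [exact/integrable_cont/cn|exact/integrable_cont/cn|].
by move=> xi _; rewrite normrM ler_piMr.
Qed.

(** The chain rule in [xi] produces the factor [x]; the zeros of [H] at the endpoints remove the
    boundary terms. *)
Lemma trig_integral_by_parts k k' H H1 x :
  (forall y, is_derive y (1 : R) k (k' y)) -> continuous k' ->
  (forall y, is_derive y (1 : R) H (H1 y)) -> continuous H1 ->
  H (- A) = 0 -> H A = 0 ->
  x * trig_integral k' H x = - trig_integral k H1 x.
Proof.
move=> dk ck' dH cH1 HNA HA.
have AA : - A < A by rewrite -subr_gt0 opprK addr_gt0.
have ck := is_derive_continuous dk; have cH := is_derive_continuous dH.
have dkx xi : is_derive xi (1 : R) (fun xi => k (x * xi)) (x * k' (x * xi)).
  have := @is_derive_line R k 0 x xi (k' (x * xi)).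
  under eq_fun do rewrite add0r mulrC.
  by rewrite add0r mulrC => /(_ (dk _)).
have LR f f1 : (forall y, is_derive y (1 : R) f (f1 y)) ->
    derivable_oo_LRcontinuous f (- A) A.
  move=> df; have cf := is_derive_continuous df; split.
  - by move=> y _; apply: ex_derive; exact: df.
  - by apply: cvg_at_right_filter; exact: cf.
  - by apply: cvg_at_left_filter; exact: cf.
have dE f f1 : (forall y, is_derive y (1 : R) f (f1 y)) ->
    {in `]- A, A[, derive1 f =1 f1}.
  by move=> df y _; rewrite derive1E; have := df y => ?; rewrite derive_val.
have := @Rintegration_by_parts R H (fun xi => k (x * xi)) H1
  (fun xi => x * k' (x * xi)) (- A) A AA.
have cxk' : continuous (fun xi => x * k' (x * xi)).
  by apply: cont_mul; [move=> ?; exact: cvg_cst|exact: cont_kernel].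
move=> /(_ (continuous_subspaceT cH1) (LR _ _ dH) (dE _ _ dH)
  (continuous_subspaceT cxk') (LR _ _ dkx) (dE _ _ dkx)).
rewrite HA HNA !mul0r subrr sub0r => <-.
rewrite /trig_integral -RintegralZl//.
  by apply: eq_Rintegral => xi _; rewrite mulrCA.
by apply: integrable_cont; apply: cont_mul => //; exact: cont_kernel.
Qed.

(** Differentiation under the integral, the derivative in [x] being dominated by [|H xi * xi|],
    which is integrable on the compact interval. *)
Lemma is_derive_trig_integral k k' H x :
  (forall y, is_derive y (1 : R) k (k' y)) -> continuous k' ->
  (forall y, `|k' y| <= 1) -> continuous H ->
  is_derive x (1 : R) (trig_integral k H)
    (trig_integral k' (fun xi => H xi * xi) x).
Proof.
move=> dk ck' k'1 cH; have ck := is_derive_continuous dk.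
pose f y xi := H xi * k (y * xi).
have df y xi : is_derive y (1 : R) (f ^~ xi) (H xi * (xi * k' (y * xi))).
  have dl : is_derive y (1 : R) (fun y => k (y * xi)) (xi * k' (y * xi)).
    have := @is_derive_line R k 0 xi y (k' (y * xi)).
    under eq_fun do rewrite add0r.
    by rewrite add0r => /(_ (dk _)).
  exact: (is_deriveZ (H xi) dl).
have d1E y xi : partial1of2 f y xi = H xi * (xi * k' (y * xi)).
  by rewrite partial1of2E; have := df y xi => ?; rewrite derive_val.
pose G (xi : R) : R := `|H xi * xi|.
have cG : continuous G.
  move=> xi; apply: cvg_norm; apply: cvgM; [exact: cH|exact: cvg_id].
have xI : `]x - 1, x + 1[%classic x by rewrite /= in_itv/=; apply/andP; split; lra.
have intf y : `]x - 1, x + 1[%classic y -> mu.-integrable `[- A, A] (EFin \o f y).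
  by move=> _; apply: integrable_cont; apply: cont_mul => //; exact: cont_kernel.
have derf y xi : `]x - 1, x + 1[%classic y -> `[- A, A]%classic xi ->
    derivable (f ^~ xi) y 1.
  by move=> _ _; apply: ex_derive; exact: df.
have Gub y xi : `]x - 1, x + 1[%classic y -> `[- A, A]%classic xi ->
    `|partial1of2 f y xi| <= G xi.
  by move=> _ _; rewrite d1E mulrA normrM ler_piMr.
have G0 xi : 0 <= G xi by rewrite /G normr_ge0.
have mA : measurable (`[- A, A]%classic : set (measurableTypeR R)).
  exact: measurable_itv.
apply: DeriveDef.
  exact: (@derivable_under_integral R _ (measurableTypeR R) mu f _ mA x _ _ xI
    intf derf G G0 (integrable_cont cG) Gub).
rewrite -derive1E.
rewrite (@differentiation_under_integral R _ (measurableTypeR R) mu f _ mA x _ _ xI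
    intf derf G G0 (integrable_cont cG) Gub).
by apply: eq_Rintegral => xi _; rewrite d1E mulrA.
Qed.

End trigonometric_integral.

Section meyer_decay.
Context (R : realType).
Implicit Types (f g H nu : R -> R).
Local Notation mu := (@lebesgue_measure R).

Lemma smooth_decay_affine n f (c a b : R) : 1 <= a ^+ 2 -> smooth_decay n f ->
  smooth_decay n (fun x => c * f (a * x + b)).
Proof.
move=> a1.
have key f0 c0 m : smooth_decay m f0 ->
    exists C, forall x, `|c0 * f0 (a * x + b)| <= C * (oneDsqr x)^-1.
  (* With y = a x + b, 1 <= a^2 gives x^2 <= (y - b)^2 <= 2 y^2 + 2 b^2, whence 1 + x^2 <= (2 + 2
     b^2) (1 + y^2). *)
  move=> /smooth_decay_bound[C C0 HC]; exists (`|c0| * (C * (2 + 2 * b ^+ 2))) => x.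
  rewrite normrM -!mulrA ler_wpM2l//; apply: le_trans (HC _) _.
  rewrite ler_wpM2l// ler_pdivlMr// mulrC ler_pdivrMr// /oneDsqr.
  set y := a * x + b.
  have : x ^+ 2 <= (y - b) ^+ 2.
    by rewrite /y addrK exprMn ler_peMl ?sqr_ge0.
  have := sqr_ge0 (y + b); have : 0 <= b ^+ 2 * y ^+ 2 by rewrite mulr_ge0 ?sqr_ge0.
  lra.
elim: n f c => [|n IH] f c sf; (split; first exact: key sf) => //.
have [_ [f' [ff' sf']]] := sf.
exists (fun x => (c * a) * f' (a * x + b)); split; last exact: IH.
move=> x; have := @is_derive_line R f b a x (f' (a * x + b)).
under eq_fun do rewrite addrC mulrC.
rewrite [b + _]addrC [x * a]mulrC => /(_ (ff' _)) H.
by apply: is_derive_eq (is_deriveZ c H) _; rewrite /GRing.scale/= mulrA.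
Qed.

Definition C2_supported (A : R) H := C2 H /\ forall xi, A <= `|xi| -> H xi = 0.

Lemma C2_supported_mul A H g : C2_supported A H -> C2 g ->
  C2_supported A (fun xi => H xi * g xi).
Proof.
move=> [CH H0] Cg; split; first exact: C2_mul.
by move=> xi /H0 ->; rewrite mul0r.
Qed.

(** The strict inequality provides a neighbourhood of [xi] on which [H] vanishes. *)
Lemma derive_supported A H H1 : (forall x, is_derive x (1 : R) H (H1 x)) ->
  (forall xi, A <= `|xi| -> H xi = 0) -> forall xi, A < `|xi| -> H1 xi = 0.
Proof.
move=> dH H0 xi Axi; have := dH xi => dHxi.
have nA : \forall y \near xi, A < `|y|.
  apply: ((@norm_continuous _ R xi) [set z | A < z]).
  by apply: open_nbhs_nbhs; split => //; exact: open_gt.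
have d0 : is_derive xi (1 : R) H 0.
  apply: (near_eq_is_derive (f := fun=> 0)).
  by apply: filterS nA => y Ay; rewrite H0// ltW.
by rewrite -(@derive_val _ _ _ _ _ _ _ d0) (@derive_val _ _ _ _ _ _ _ dHxi).
Qed.

Section decay.
Context (A : R).
Hypothesis A0 : 0 < A.
(** Endpoints strictly beyond [A], where both [H] and its derivative vanish. *)
Let B := A + 1.
Let B0 : 0 < B. Proof. by rewrite addr_gt0. Qed.
Let normB : `|B| = B. Proof. by rewrite gtr0_norm. Qed.
Let AB : A < B. Proof. by rewrite ltrDl. Qed.

(** Two integrations by parts turn x^2 times the integral into one against [H2], which is bounded;
    adding the direct bound on the integral itself gives the weight 1 + x^2. *)
Lemma trig_integral_decay k0 k1 k2 H :
  (forall y, is_derive y (1 : R) k0 (k1 y)) ->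
  (forall y, is_derive y (1 : R) k1 (k2 y)) ->
  continuous k2 -> (forall y, `|k0 y| <= 1) -> (forall y, `|k2 y| <= 1) ->
  C2_supported A H ->
  exists C, forall x, `|trig_integral B k2 H x| <= C * (oneDsqr x)^-1.
Proof.
move=> dk0 dk1 ck2 k01 k21 [[H1 [H2 [dH dH1 cH2]]] H0].
have H10 := derive_supported dH H0.
have cH := is_derive_continuous dH; have cH1 := is_derive_continuous dH1.
have ck1 := is_derive_continuous dk1; have ck0 := is_derive_continuous dk0.
exists (\int[mu]_(xi in `[- B, B]) `|H xi| + \int[mu]_(xi in `[- B, B]) `|H2 xi|) => x.
have E : x ^+ 2 * trig_integral B k2 H x = trig_integral B k0 H2 x.
  rewrite expr2 -mulrA (trig_integral_by_parts B0 _ dk1 ck2 dH cH1).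
  - rewrite mulrN (trig_integral_by_parts B0 _ dk0 ck1 dH1 cH2) ?opprK//.
    + by apply: H10; rewrite normrN normB.
    + by apply: H10; rewrite normB.
  - by apply: H0; rewrite normrN normB ltW.
  - by apply: H0; rewrite normB ltW.
rewrite ler_pdivlMr// /oneDsqr mulrDr mulr1 lerD//.
  exact: trig_integral_bound.
rewrite -[x ^+ 2]ger0_norm ?sqr_ge0// mulrC -normrM E.
exact: trig_integral_bound.
Qed.

(** Differentiating in [x] exchanges cosine and sine up to sign and replaces [H xi] by [H xi * xi],
    again C^2 with the same support bound; hence the joint induction over all [H]. *)
Lemma cos_sin_integral_decay n H : C2_supported A H ->
  smooth_decay n (trig_integral B cos H) /\ smooth_decay n (trig_integral B sin H).
Proof.
have cN1 (y : R) : `|- cos y| <= 1 by rewrite normrN cos_max.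
have sN1 (y : R) : `|- sin y| <= 1 by rewrite normrN sin_max.
have dNs (y : R) : is_derive y (1 : R) (fun y : R => - sin y) (- cos y).
  exact: is_deriveN.
have dNc (y : R) : is_derive y (1 : R) (fun y : R => - cos y) (sin y).
  by have := is_deriveN (is_derive_cos y); rewrite opprK.
have cNs : continuous (fun y : R => - sin y).
  exact: is_derive_continuous dNs.
elim: n H => [|n IH] H HH.
  split; split => //.
    exact: (trig_integral_decay dNc _ (@continuous_cos _) cN1 (@cos_max _) HH).
  exact: (trig_integral_decay dNs dNc (@continuous_sin _) sN1 (@sin_max _) HH).
have [cIH sIH] := IH _ (C2_supported_mul HH (C2_id R)).
have cH : continuous H.
  by case: HH => -[H1 [H2 [dH _ _]]] _; exact: is_derive_continuous dH.
split; split.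
- exact: (trig_integral_decay dNc _ (@continuous_cos _) cN1 (@cos_max _) HH).
- exists (trig_integral B (fun y => - sin y) (fun xi => H xi * xi)); split.
    by move=> x; apply: is_derive_trig_integral.
  (* The sign of [- sin] is moved into the amplitude. *)
  have [_ sIHN] := IH _ (C2_supported_mul HH (C2_mul (C2_cst (- 1)) (C2_id R))).
  rewrite (_ : trig_integral _ _ _ = trig_integral B sin (fun xi => H xi * (- 1 * xi)))//.
  by apply/funext => x; apply: eq_Rintegral => xi _; rewrite mulN1r !mulrN mulNr.
- exact: (trig_integral_decay dNs dNc (@continuous_sin _) sN1 (@sin_max _) HH).
- exists (trig_integral B cos (fun xi => H xi * xi)); split=> // x.
  apply: is_derive_trig_integral => //; first exact: continuous_cos.
  exact: cos_max.
Qed.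

Lemma inv_fourier_even_decay n g : C2_supported A g ->
  smooth_decay n (inv_fourier_even g).
Proof.
move=> Hg; have [+ _] := cos_sin_integral_decay n Hg.
move=> /(smooth_decay_affine (2 * pi)^-1 0 (a := 1)); rewrite expr1n => /(_ (lexx _)).
congr smooth_decay; apply/funext => x; rewrite /inv_fourier_even mul1r addr0.
congr (_ * _); rewrite /trig_integral Rintegral_mkcond.
apply: eq_Rintegral => xi _; rewrite /patch; case: ifPn => //.
rewrite notin_setE/= in_itv/= -ler_norml => /negP; rewrite -ltNge => Bxi.
by rewrite (Hg.2 xi) ?mul0r// ltW// (lt_trans AB).
Qed.

End decay.
End meyer_decay.

(** * The atoms *)

Section meyer.
Context (R : realType) (nu : R -> R).
Hypothesis nuM : meyer_cutoff nu.

Lemma C2_cutoff : C2 nu.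
Proof.
have [nuD _ _ _] := nuM.
have H n x : is_derive x (1 : R) (derive1n n (nu : R -> R^o))
    (derive1n n.+1 (nu : R -> R^o) x).
  by apply: DeriveDef; [exact: nuD|rewrite derive1nS derive1E].
exists (derive1n 1 (nu : R -> R^o)), (derive1n 2 (nu : R -> R^o)); split.
- exact: (H 0%N).
- exact: (H 1%N).
- exact: is_derive_continuous (H 2%N).
Qed.

(* The cutoff vanishes on the negative half-line, so the two terms have disjoint
   supports and the absolute value disappears. *)
Let arg (c xi : R) : R := pi / 2 * (nu (c * xi + -1) + nu (- c * xi + -1)).

Let argE (c xi : R) : 0 <= c -> pi / 2 * nu (c * `|xi| - 1) = arg c xi.
Proof.
move=> c0; rewrite /arg; have [_ nu0 _ _] := nuM; congr (_ * _).
have [xi0|xi0] := leP 0 xi.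
  have h : - c * xi + -1 <= 0 by have := mulr_ge0 c0 xi0; lra.
  by rewrite (nu0 _ h) addr0 ger0_norm.
have h : c * xi + -1 <= 0 by have := mulr_ge0_le0 c0 (ltW xi0); lra.
by rewrite (nu0 _ h) add0r ltr0_norm// mulNr mulrN.
Qed.

Let C2_arg c : C2 (arg c).
Proof.
apply: C2_mul; first exact: C2_cst.
by apply: C2_add; apply: C2_affine; exact: C2_cutoff.
Qed.

(** The argument of [nu] in the low-pass filter is [c |xi| - 1]; it reaches 1 at [|xi| = 2 / c],
    that is 4 pi / 3. *)
Let c : R := 3 / (2 * pi).
Let c0 : 0 < c. Proof. by rewrite divr_gt0// mulr_gt0// pi_gt0. Qed.

Let lowpassE xi : meyer_lowpass nu xi = cos (arg c xi).
Proof.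
rewrite /meyer_lowpass -argE ?ltW// /c; congr (cos (_ * nu (_ - 1))).
by rewrite mulrAC.
Qed.

Let lowpass0 xi : 2 / c <= `|xi| -> meyer_lowpass nu xi = 0.
Proof.
rewrite ler_pdivrMr// => cxi; rewrite lowpassE -argE ?ltW//.
have [_ _ nu1 _] := nuM; rewrite nu1 ?mulr1 ?cos_pihalf//.
by rewrite lerBrDr mulrC.
Qed.

Lemma lowpass_supported : C2_supported (2 / c) (meyer_lowpass nu).
Proof.
split; last exact: lowpass0.
rewrite (_ : meyer_lowpass nu = fun xi => cos (arg c xi)).
  exact: C2_comp (@C2_cos R) (C2_arg c).
by apply/funext => xi; exact: lowpassE.
Qed.

(** The low-pass factor is evaluated at [xi / 2], which doubles the radius. *)
Lemma bandpass_supported : C2_supported (2 * (2 / c)) (meyer_bandpass nu).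
Proof.
split=> [|xi cxi]; last first.
  rewrite /meyer_bandpass lowpass0 ?mulr0//.
  by rewrite normrM [X in _ <= _ * X]ger0_norm// ler_pdivlMr// mulrC.
rewrite (_ : meyer_bandpass nu = fun xi =>
    sin (arg c xi) * meyer_lowpass nu (2^-1 * xi + 0)).
  apply: C2_mul; first exact: C2_comp (@C2_sin R) (C2_arg c).
  exact: C2_affine lowpass_supported.1.
apply/funext => xi; rewrite /meyer_bandpass addr0 [2^-1 * _]mulrC; congr (sin _ * _).
by rewrite -argE ?ltW// /c; congr (_ * nu (_ - 1)); rewrite mulrAC.
Qed.

Let d0 : 0 < 2 / c. Proof. by rewrite divr_gt0. Qed.

Lemma meyer_phi_decay n : smooth_decay n (meyer_phi nu).
Proof. exact: (inv_fourier_even_decay d0 n lowpass_supported). Qed.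

Lemma meyer_psi_decay n : smooth_decay n (meyer_psi nu).
Proof.
have d1 : 0 < 2 * (2 / c) by rewrite mulr_gt0.
have a1 : 1 <= 1 ^+ 2 :> R by rewrite expr1n.
have := smooth_decay_affine 1 (- (1 / 2)) a1
  (inv_fourier_even_decay d1 n bandpass_supported).
congr smooth_decay; apply/funext => x.
by rewrite /meyer_psi !mul1r.
Qed.

(** * Regularity of the atoms, and their decay in scale and position *)

Section atoms.
Context (d : nat) (s : R).
Hypothesis hs : d%:R + 1 < s.

Let eta (b : bool) : R -> R := if b then meyer_psi nu else meyer_phi nu.

Let eta_decay n b : smooth_decay n (eta b).
Proof. by case: b; [exact: meyer_psi_decay|exact: meyer_phi_decay]. Qed.

Lemma tensor_wavelet_bound : exists2 C, 0 <= C &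
  forall (eps : {ffun 'I_d -> bool}) x,
    `|tensor_wavelet nu eps x| <= C * decay_weight x.
Proof.
have [C1 C10 H1] := smooth_decay_bound (eta_decay 0 true).
have [C2 C20 H2] := smooth_decay_bound (eta_decay 0 false).
have [C [C0 HC]] : exists C, 0 <= C /\ forall b x, `|eta b x| <= C * (oneDsqr x)^-1.
  exists (C1 + C2); split; first exact: addr_ge0.
  case=> x; [apply: le_trans (H1 x) _|apply: le_trans (H2 x) _];
    by rewrite ler_wpM2r ?invr_ge0 ?lerDl ?lerDr// ltW.
exists (\prod_(i < d) C) => [|eps x]; first by apply: prodr_ge0.
rewrite /tensor_wavelet /decay_weight /tens normr_prod -big_split/=.
by apply: ler_prod => i _; rewrite normr_ge0; exact: HC.
Qed.

(** Dilation and shift act coordinatewise and are absorbed into the one-dimensional factors, whose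
    decay survives because 2^j >= 1. *)
Lemma atom_tens (l : wavelet_index d) : exists (a : R) (f : 'I_d -> R -> R),
  (forall n i, smooth_decay n (f i)) /\ atom nu s l = fun x => a * tens f x.
Proof.
have aff (eps : {ffun 'I_d -> bool}) (j : nat) (k : 'rV[int]_d) (n : nat) i :
    smooth_decay n (fun y => 1 * eta (eps i) (2 ^+ j * y + - (k ord0 i)%:~R)).
  apply: smooth_decay_affine => //.
  by rewrite -exprM exprn_ege1// ler1n.
case: l => [k|[[j k] eps]].
  exists 1, (fun i y => 1 * eta ([ffun=> false] i) (2 ^+ 0 * y + - (k ord0 i)%:~R)).
  split; first by move=> n i; exact: (aff [ffun=> false] 0%N).
  apply/funext => x; rewrite /= mul1r; apply: eq_bigr => i _.
  by rewrite !mxE expr0 !mul1r.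
exists (2 `^ (- (j%:R * (s - d%:R / 2))) * 2 `^ (j%:R * d%:R / 2)),
  (fun i y => 1 * eta (val eps i) (2 ^+ j * y + - (k ord0 i)%:~R)).
split; first by move=> n i; exact: aff.
apply/funext => x; rewrite /= /wavelet [LHS]mulrA; congr (_ * _).
by apply: eq_bigr => i _; rewrite !mxE mul1r.
Qed.

Lemma atomic_sum_besov (r K : nat) (a : 'I_K -> R) (l : 'I_K -> wavelet_index d) :
  s < r%:R -> besov s r (atomic_sum nu s a l).
Proof.
move=> sr; have r0 : (0 < r)%N.
  rewrite -(ltr_nat R); apply: lt_trans sr; apply: lt_trans hs.
  by rewrite ltr_wpDl.
have /choice[q Hq] : forall j, exists p : R * ('I_d -> R -> R),
    (forall n i, smooth_decay n (p.2 i)) /\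
    atom nu s (l j) = fun x => p.1 * tens p.2 x.
  by move=> j; have [b [f Hf]] := atom_tens (l j); exists (b, f).
rewrite (_ : atomic_sum nu s a l =
    fun x => \sum_j (a j * (q j).1) * tens (q j).2 x).
  apply: smooth_l1_besov => //; apply: smooth_l1_sum => j.
  by apply: smooth_l1_tens => // i; exact: (Hq j).1.
apply/funext => x; apply: eq_bigr => j _.
by rewrite (Hq j).2 mulrA.
Qed.

Lemma finite_int_box (M : nat) :
  finite_set [set k : 'rV[int]_d | forall i, (`|k ord0 i| <= M)%N].
Proof.
pose g (f : {ffun 'I_d -> 'I_(M + M).+1}) : 'rV[int]_d := \row_i ((f i : nat)%:Z - M%:Z).
apply: (@sub_finite_set _ _ (g @` setT)); last exact/finite_image/finite_finset.
move=> k /= kM; exists [ffun i => inord (absz (k ord0 i + M%:Z))] => //.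
apply/rowP => i; rewrite mxE ffunE; move: (kM i); move: (k ord0 i) => z zM.
rewrite inordK; lia.
Qed.

Lemma wavelet_index_finite (J M : nat) :
  finite_set [set l : wavelet_index d | match l with
    | inl k => forall i, (`|k ord0 i| <= M)%N
    | inr (j, k, _) => (j < J)%N /\ forall i, (`|k ord0 i| <= M)%N
    end].
Proof.
set S := [set l | _].
pose box := [set k : 'rV[int]_d | forall i, (`|k ord0 i| <= M)%N].
have fb : finite_set box := finite_int_box M.
apply: (@sub_finite_set _ _ ((inl @` box) `|`
  (inr @` ((`I_J `*` box) `*` [set: nonzero_type d])))).
  move=> [k|[[j k] eps]] => [kM|[jJ kM]]; first by left; exists k.
  by right; exists (j, k, eps).
rewrite finite_setU; split; first exact: finite_image.
apply: finite_image; apply: finite_setX; last exact: finite_finset.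
by apply: finite_setX => //; exact: finite_II.
Qed.

Lemma decay_weight_le (x : 'rV[R]_d) i : decay_weight x <= (oneDsqr (x ord0 i))^-1.
Proof.
rewrite /decay_weight /tens (bigD1 i)//= ler_piMr ?invr_ge0 ?(le_trans ler01)//.
by apply: Num.Theory.prodr_ile1 => j _; rewrite invr_ge0 oneDsqrV_le1 (le_trans ler01).
Qed.

(** As s > d + 1, atoms of scale [j] are at most C 2^(-j), which leaves finitely many scales; at
    each of them the decay of the wavelet at 2^j p - k leaves finitely many [k]. *)
Lemma atom_vanishing_at (p : 'rV[R]_d) (e : R) : 0 < e ->
  finite_set [set l | e < `|atom nu s l p|].
Proof.
move=> e0; have [C C0 HC] := tensor_wavelet_bound.
have [J CJ] : exists J : nat, C / e < J%:R.
  exists (Num.truncn (C / e)).+1.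
  by have /andP[] := Num.Theory.truncn_itv (divr_ge0 C0 (ltW e0)).
(* Bounds the entries of k = 2^j p - y for an atom exceeding [e]: then |y_i| <= 1 + y_i^2 < C / e in
   each coordinate. *)
pose B := C / e + 2 ^+ J * `|p|.
have B0 : 0 <= B by rewrite addr_ge0 ?divr_ge0 ?mulr_ge0 ?exprn_ge0// ltW.
pose M := (Num.truncn B).+1.
have BM : B < M%:R by have /andP[] := Num.Theory.truncn_itv B0.
have kbound (eps : {ffun 'I_d -> bool}) (j : nat) (k : 'rV[int]_d) i : (j <= J)%N ->
    e < `|tensor_wavelet nu eps (2 ^+ j *: p - int_shift R k)| -> (`|k ord0 i| <= M)%N.
  move=> jJ /lt_le_trans/(_ (HC _ _)) eC.
  set y := (2 ^+ j *: p - int_shift R k) ord0 i.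
  have : e < C * (oneDsqr y)^-1.
    by apply: lt_le_trans eC _; rewrite ler_wpM2l// decay_weight_le.
  rewrite ltr_pdivlMr ?(lt_le_trans ltr01)// mulrC -ltr_pdivlMr// => yC.
  have yy : `|y| <= oneDsqr y.
    rewrite /oneDsqr -real_normK ?num_real//; have := sqr_ge0 (`|y| - 1).
    have := normr_ge0 y; nra.
  have kE : (k ord0 i)%:~R = 2 ^+ j * p ord0 i - y by rewrite /y !mxE; ring.
  rewrite -(ler_nat R) natr_absz intr_norm kE; apply/ltW/(le_lt_trans _ BM).
  apply: le_trans (ler_normB _ _) _; rewrite addrC lerD//.
    exact/ltW/(le_lt_trans yy).
  rewrite normrM ger0_norm ?exprn_ge0// ler_pM ?exprn_ge0//.
    by rewrite ler_weXn2l// ler1n.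
  by rewrite [leRHS]/Num.Def.normr/= mx_normrE; apply/bigmax_geP; right; exists (ord0, i).
apply: sub_finite_set (wavelet_index_finite J M) => -[k|[[j k] eps]] /= el.
  move=> i; apply: (kbound [ffun=> false] 0%N) => //.
  by rewrite expr0 scale1r.
move: el; rewrite /wavelet; set T := tensor_wavelet _ _ _ => el.
(* The exponents add up to - j (s - d), which is at most - j. *)
have aT : `|2 `^ (- (j%:R * (s - d%:R / 2))) * (2 `^ (j%:R * d%:R / 2) * T)|
    <= (2 ^+ j)^-1 * `|T|.
  rewrite mulrA normrM ler_wpM2r// ger0_norm ?mulr_ge0 ?powR_ge0//.
  rewrite -powRD ?pnatr_eq0 ?implybT//.
  rewrite -powR_mulrn// -powRN ler_powR ?ler1n//.
  have sd0 : 0 <= s - d%:R - 1 by rewrite -addrA -opprD subr_ge0 ltW.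
  by have := mulr_ge0 (ler0n R j) sd0; lra.
have {aT}el := lt_le_trans el aT.
(* The chain is j < 2^j < C / e < J. *)
have jJ : (j < J)%N.
  rewrite -(ltr_nat R); apply: lt_trans CJ.
  have j2 : (j%:R : R) < 2 ^+ j by rewrite -natrX ltr_nat ltn_expl.
  apply: lt_trans j2 _; rewrite ltr_pdivlMr// mulrC -ltr_pdivlMr ?exprn_gt0//.
  apply: lt_le_trans el _; rewrite mulrC ler_wpM2r ?invr_ge0 ?exprn_ge0//.
  by apply: le_trans (HC _ _) _; rewrite ler_piMr// decay_weight_le1.
split=> // i; apply: (kbound (val eps) j) => //; first exact: ltnW.
apply: lt_le_trans el _; rewrite ler_piMl// invf_le1 ?exprn_gt0//.
by rewrite exprn_ege1// ler1n.
Qed.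

Lemma atom_vanishing (N : nat) (x : 'I_N -> 'rV[R]_d) :
  vanishing (fun l => samples x (@atom R d nu s l)).
Proof.
move=> e e0.
apply: (@sub_finite_set _ _ (\bigcup_(i in [set: 'I_N])
  [set l | e < `|atom nu s l (x i)|])).
  move=> l /=; rewrite [X in _ < X -> _]/Num.Def.normr/= mx_normrE.
  move=> /bigmax_gtP[|[[i j] _ /=]]; first by rewrite ltNge ltW.
  by rewrite mxE => ejl; exists j.
apply: bigcup_finite => [|i _]; first exact: finite_finset.
exact: atom_vanishing_at.
Qed.

End atoms.
End meyer.

Theorem theorem6p4 (R : realType) (d : nat) (hd : (1 <= d)%N)
    (s : R) (hs : d%:R + 1 < s)
    (r : nat) (hr : s < r%:R)
    (nu : R -> R) (hnu : meyer_cutoff nu)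
    (N : nat) (x : 'I_N -> 'rV[R]_d) (hx : injective x)
    (G : 'rV[R]_N -> \bar R) (hG0 : forall y, (0 <= G y)%E)
    (hGproper : proper_fun G) (hGlsc : lower_semicontinuous G)
    (hGcoercive : coercive_fun G)
    (mu : R) (hmu : 0 < mu) :
  let solP := minimizer (besov s r) (objective nu s mu x G) in
  let solK := fun K : nat =>
    minimizer [set: ('I_K -> R) * ('I_K -> wavelet_index d)]
      (discrete_objective nu s mu x G (K := K)) in
  (exists f : 'rV[R]_d -> R, solP f) /\
  (exists (K : nat) (a : 'I_K -> R) (l : 'I_K -> wavelet_index d),
     (K <= N)%N /\ solP (atomic_sum nu s a l)) /\
  (forall K : nat, (N <= K)%N ->
     (exists p, solK K p) /\
     (forall p, solK K p -> solP (atomic_sum nu s p.1 p.2))).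
Proof.
apply: sparse_representer => // [|K a l]; first exact: atom_vanishing.
exact: atomic_sum_besov.
Qed.
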